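(* Let $\mathfrak{M}$ be an $\mathscr{L}$-structure. Then $\mathfrak{M}$ is p.e. interpretable in the $\mathscr{L}_a$-structure $\mathbb{N}$ if and only if $\mathfrak{M}$ is listable.
   Context: $\mathscr{L}_a=\{0,1,+,\times,=\}$ with $\mathbb{N}$ the semiring of non-negative integers. All languages contain $=$, interpreted as equality. Listable means recursively enumerable. $\mathfrak{M}$ (domain $M$) is listable if there is a surjection $\rho:\mathbb{N}\to M$ such that for every symbol $s\in\mathscr{L}$ the preimage of its interpretation (graph for function symbols) under the coordinatewise map induced by $\rho$ is listable. A p.e. interpretation of $\mathfrak{M}$ in an $\mathscr{K}$-structure $\mathfrak{N}$ (domain $N$) of rank $r$ is a surjection $\theta:D\to M$ with $D\subseteq N^r$ positive existentially $\mathscr{K}$-definable (without parameters, using only atomic formulas, $\wedge,\vee,\exists$), such that for each $s\in\mathscr{L}$ the preimage of $s^{\mathfrak{M}}$ under the coordinatewise map induced by $\theta$ is p.e. $\mathscr{K}$-definable. *)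

(* Defs.v *)
From mathcomp Require Import all_boot.
From mathcomp Require Import boolp classical_sets functions.

Set Implicit Arguments.
Unset Strict Implicit.
Unset Printing Implicit Defensive.

Local Open Scope classical_set_scope.

(* Equality belongs to every language, so only the other symbols are listed.
   Constants are function symbols of arity 0. *)
Record language := Language {
  fsym : Type;
  farity : fsym -> nat;
  rsym : Type;
  rarity : rsym -> nat
}.

Record structure (L : language) := Structure {
  dom :> Type;
  dom_inhabited : inhabited dom;
  fint : forall f : fsym L, (farity f).-tuple dom -> dom;
  rint : forall R : rsym L, set ((rarity R).-tuple dom)
}.

Arguments fint {L s} f _.
Arguments rint {L s} R _.

Inductive symbol (L : language) : Type :=
| SymEq
| SymFun (f : fsym L)
| SymRel (R : rsym L).

Definition symbol_arity (L : language) (s : symbol L) : nat :=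
  match s with
  | SymEq => 2
  | SymFun f => (farity f).+1
  | SymRel R => rarity R
  end.

(* A function symbol is interpreted by its graph, with the value last. *)
Definition symbol_int (L : language) (M : structure L) (s : symbol L) :
    set ((symbol_arity s).-tuple M) :=
  match s return set ((symbol_arity s).-tuple M) with
  | SymEq => [set t | tnth t ord0 = tnth t ord_max]
  | SymFun f => range (fun x => rcons_tuple x (fint f x))
  | SymRel R => rint R
  end.

Arguments symbol_int {L} M s _.

(* Terms and positive existential formulas with free variables among
   x_0, ..., x_(n-1); the quantifier binds x_0 and shifts the other variables. *)
Inductive term (K : language) (n : nat) : Type :=
| TVar (i : 'I_n)
| TApp (f : fsym K) (args : 'I_(farity f) -> term K n).

Inductive pe_formula (K : language) : nat -> Type :=
| PEq n (t u : term K n) : pe_formula K n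
| PRel n (R : rsym K) (args : 'I_(rarity R) -> term K n) : pe_formula K n
| PAnd n (phi psi : pe_formula K n) : pe_formula K n
| POr n (phi psi : pe_formula K n) : pe_formula K n
| PEx n (phi : pe_formula K n.+1) : pe_formula K n.

Fixpoint teval (K : language) (N : structure K) (n : nat)
    (v : n.-tuple N) (t : term K n) : N :=
  match t with
  | TVar i => tnth v i
  | TApp f args => fint f [tuple teval v (args i) | i < farity f]
  end.

Fixpoint sat (K : language) (N : structure K) (n : nat)
    (phi : pe_formula K n) : n.-tuple N -> Prop :=
  match phi in pe_formula _ n return n.-tuple N -> Prop with
  | PEq _ t u => fun v => teval v t = teval v u
  | PRel _ R args => fun v => rint R [tuple teval v (args i) | i < rarity R]
  | PAnd _ phi psi => fun v => sat phi v /\ sat psi v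
  | POr _ phi psi => fun v => sat phi v \/ sat psi v
  | PEx _ phi => fun v => exists x : N, sat phi (cons_tuple x v)
  end.

Definition pe_definable (K : language) (N : structure K) (n : nat)
    (S : set (n.-tuple N)) : Prop :=
  exists phi : pe_formula K n, S = [set v | sat phi v].

(* The identification of (T^r)^n with T^(n * r), by concatenation. *)
Definition flatten_set (T : Type) (n r : nat) (S : set (n.-tuple (r.-tuple T))) :
    set ((n * r).-tuple T) :=
  [set u | exists2 w, S w & val u = flatten [seq val x | x <- w]].

(* The surjection from D onto M is given by a total function theta; its values
   outside D are irrelevant. *)
Definition is_pe_interpretation (L K : language)
    (M : structure L) (N : structure K) (r : nat)
    (D : set (r.-tuple N)) (theta : r.-tuple N -> M) : Prop :=
  [/\ pe_definable D,
      set_surj D setT theta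
    & forall s : symbol L,
        pe_definable
          (flatten_set [set w | (forall i, D (tnth w i)) /\
                                symbol_int M s (map_tuple theta w)])].

Definition pe_interpretable (L K : language)
    (M : structure L) (N : structure K) : Prop :=
  exists (r : nat) (D : set (r.-tuple N)) (theta : r.-tuple N -> M),
    is_pe_interpretation D theta.

(* Codes of partial recursive functions from nat^n to nat. *)
Inductive partrec : nat -> Type :=
| RZero n : partrec n
| RSucc : partrec 1
| RProj n (i : 'I_n) : partrec n
| RComp m n (f : partrec m) (g : 'I_m -> partrec n) : partrec n
| RRec n (f : partrec n) (g : partrec n.+2) : partrec n.+1
| RMu n (f : partrec n.+1) : partrec n.

(* [computes f v y]: the function coded by f is defined at v, with value y.
   RRec f g is h with h (0, x) = f x and h (k + 1, x) = g (k, h (k, x), x). *)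
Fixpoint computes (n : nat) (f : partrec n) : n.-tuple nat -> nat -> Prop :=
  match f in partrec n return n.-tuple nat -> nat -> Prop with
  | RZero _ => fun _ y => y = 0
  | RSucc => fun v y => y = (thead v).+1
  | RProj _ i => fun v y => y = tnth v i
  | RComp m _ f g => fun v y =>
      exists2 w : m.-tuple nat,
        forall i, computes (g i) v (tnth w i) & computes f w y
  | RRec _ f g => fun v y =>
      let x := behead_tuple v in
      (fix rec (k : nat) (y : nat) : Prop :=
         match k with
         | 0 => computes f x y
         | k'.+1 => exists2 z, rec k' z &
                      computes g (cons_tuple k' (cons_tuple z x)) y
         end) (thead v) y
  | RMu _ f => fun v y =>
      computes f (cons_tuple y v) 0 /\
      forall z, z < y -> exists k, computes f (cons_tuple z v) k.+1
  end.

(* Recursively enumerable sets, as domains of partial recursive functions. *)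
Definition listable_set (n : nat) (S : set (n.-tuple nat)) : Prop :=
  exists f : partrec n, S = [set v | exists y, computes f v y].

Definition listable (L : language) (M : structure L) : Prop :=
  exists2 rho : nat -> M,
    set_surj setT setT rho &
    forall s : symbol L,
      listable_set [set v | symbol_int M s (map_tuple rho v)].

Inductive arith_fsym : Type := AZero | AOne | AAdd | AMul.

Definition arith_farity (f : arith_fsym) : nat :=
  match f with AZero | AOne => 0 | AAdd | AMul => 2 end.

Definition arith_language : language :=
  Language arith_farity (of_void nat).

Definition nat_fint (f : arith_fsym) : (arith_farity f).-tuple nat -> nat :=
  match f return (arith_farity f).-tuple nat -> nat with
  | AZero => fun _ => 0
  | AOne => fun _ => 1
  | AAdd => fun v => tnth v ord0 + tnth v ord_max
  | AMul => fun v => tnth v ord0 * tnth v ord_max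
  end.

Definition nat_structure : structure arith_language :=
  @Structure arith_language nat (inhabits 0) nat_fint
    (fun R : void => match R with end).

(* Main.v *)
(** If M is listed by rho, then theta = rho on N itself is an interpretation, because
    the listable preimages are p.e. definable by the Matiyasevich-Robinson-Davis-Putnam
    theorem.  For the latter, the Lucas sequence 0, 1, b, b^2 - 1, ... solves
    x^2 - b x y + y^2 = 1 and is Diophantine by Matiyasevich's congruences; it yields
    exponentiation, then binomial coefficients and factorials, then bounded universal
    quantification by a Chinese remainder coding whose moduli multiply to a binomial
    coefficient; primitive recursion codes the sequence of values as base B digits.

    Conversely, a p.e. formula is equivalent to an equation F(w, x) = 0 in w with F
    computable.  Hence the nonempty p.e. domain of an interpretation theta is the range
    of a total computable e, and rho = theta o e lists M. *)

Require Import Defs.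
From Stdlib Require Import ZArith Znumtheory Zpow_facts Lia Zwf.
From mathcomp Require Import all_boot.
From mathcomp Require Import boolp classical_sets functions.
From mathcomp Require Import zify.

Local Open Scope nat_scope.

Set Implicit Arguments.
Unset Strict Implicit.
Unset Printing Implicit Defensive.

(** * Lucas sequences *)

Section LucasSequence.

Local Open Scope Z_scope.

(** Two obstacles shape the proof. Recursion and minimization require a condition for every k below
    a variable bound, hence an unbounded number of witnesses, while an equation has a fixed number
    of unknowns. All instances are therefore merged into one congruence modulo a product of moduli
    whose prime factors exceed the values of both sides, so that the congruence gives back equality;
    that the product has a closed form as a binomial coefficient is the reason for the detour
    through exponentiation. Secondly, the norm equation says that a number is a Lucas term but hides
    its index. The index is read off from a second sequence, whose base w is congruent to 2, because
    in base 2 the n-th term is n. In the converse direction a candidate point and its witness are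
    packed into one number, and failures are sent to one fixed point of the domain, which keeps the
    enumeration total. *)

Fixpoint lucas (b : Z) (n : nat) : Z :=
  match n with
  | 0%nat => 0
  | n'.+1 => match n' with 0%nat => 1 | n''.+1 => b * lucas b n' - lucas b n'' end
  end.

Lemma lucas0 b : lucas b 0 = 0.
Proof. by []. Qed.

Lemma lucas1 b : lucas b 1 = 1.
Proof. by []. Qed.

Lemma lucasSS b n : lucas b n.+2 = b * lucas b n.+1 - lucas b n.
Proof. by []. Qed.

Lemma lucas_add b n m :
  lucas b (n + m).+1 = lucas b n.+1 * lucas b m.+1 - lucas b n * lucas b m.
Proof.
elim: m n => [|m IHm] n; first by rewrite addn0 lucas1 lucas0; ring.
by rewrite addnS -addSn IHm !lucasSS; ring.
Qed.

Lemma lucas_norm b n :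
  lucas b n.+1 * lucas b n.+1 - b * lucas b n.+1 * lucas b n
    + lucas b n * lucas b n = 1.
Proof.
elim: n => [|n IHn]; first by rewrite lucas1 lucas0; ring.
by rewrite -[RHS]IHn lucasSS; ring.
Qed.

Lemma lucas_bounds b n : 2 <= b -> 0 <= lucas b n < lucas b n.+1.
Proof.
move=> b2; elim: n => [|n IHn]; first by rewrite /=; lia.
by rewrite lucasSS; nia.
Qed.

Lemma lucas_ge0 b n : 2 <= b -> 0 <= lucas b n.
Proof. by move/(lucas_bounds n); lia. Qed.

Lemma lucas_lt b m n : 2 <= b -> (m < n)%nat -> lucas b m < lucas b n.
Proof.
move=> b2; elim: n => // n IHn; rewrite ltnS leq_eqVlt => /orP[/eqP ->|/IHn].
  by have := lucas_bounds n b2; lia.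
by have := lucas_bounds n b2; lia.
Qed.

Lemma lucas_le b m n : 2 <= b -> (m <= n)%nat -> lucas b m <= lucas b n.
Proof.
move=> b2; rewrite leq_eqVlt => /orP[/eqP ->|/(lucas_lt b2)]; lia.
Qed.

Lemma lucas_ge_index b n : 2 <= b -> Z.of_nat n <= lucas b n.
Proof.
move=> b2; elim: n => [|n IHn]; first by rewrite /=; lia.
by have := lucas_bounds n b2; lia.
Qed.

Lemma lucas_ge_pow b n : 2 <= b -> (b - 1) ^ Z.of_nat n <= lucas b n.+1.
Proof.
move=> b2; elim: n => [|n IHn]; first by rewrite /=; lia.
rewrite Nat2Z.inj_succ Z.pow_succ_r; last lia.
by rewrite lucasSS; have := lucas_bounds n b2; nia.
Qed.

(** Descent: (y, b y - x) is again a solution, and x (b y - x) = y^2 - 1 together with y < x keeps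
    it in range with a smaller second entry, until y = 0. *)
Lemma lucas_of_norm b x y : 2 <= b -> 0 <= y -> y < x ->
  x * x - b * x * y + y * y = 1 ->
  exists n, x = lucas b n.+1 /\ y = lucas b n.
Proof.
move=> b2 y0; elim/(well_founded_ind (Zwf_well_founded 0)): y x y0 => y IHy x y0 yx xy.
have [y0E|yn0] := Z.eq_dec y 0; first subst y.
  by exists 0%nat; split=> //; rewrite lucas1; clear IHy; nia.
have xz : x * (b * y - x) = y * y - 1 by lia.
have z0 : 0 <= b * y - x by nia.
have zy : b * y - x < y by nia.
have [|//|//||n [yE zE]] := IHy (b * y - x) _ y.
- by split; lia.
- by rewrite -[RHS]xy; ring.
- by exists n.+1; rewrite lucasSS -zE -yE; split=> //; ring.
Qed.

Lemma lucas_of_norm_sym b x y : 2 <= b -> 0 <= x -> 0 <= y ->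
  x * x - b * x * y + y * y = 1 -> exists n, x = lucas b n.
Proof.
move=> b2 x0 y0 xy.
have [yx|[E|xlty]] := Z.lt_total y x.
- by have [n [-> _]] := lucas_of_norm b2 y0 yx xy; exists n.+1.
- subst y; nia.
- have [|n [_ ->]] := lucas_of_norm b2 x0 xlty; last by exists n.
  by rewrite -[RHS]xy; ring.
Qed.

(** The n-th term is an integer polynomial in the base. *)
Lemma lucas_mod d b w n :
  Z.divide d (b - w) -> Z.divide d (lucas b n - lucas w n).
Proof.
move=> [e de].
suff [] : Z.divide d (lucas b n - lucas w n) /\
          Z.divide d (lucas b n.+1 - lucas w n.+1) by [].
elim: n => [|n [[k kE] [l lE]]]; first by split; exists 0.
split; first by exists l.
exists (b * l + e * lucas w n.+1 - k); rewrite !lucasSS.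
transitivity (b * (lucas b n.+1 - lucas w n.+1) + (b - w) * lucas w n.+1
  - (lucas b n - lucas w n)); first by ring.
by rewrite lE de kE; ring.
Qed.

(** This makes indices visible: if w is 2 modulo u, then the n-th term for w is n modulo u. *)
Lemma lucas2 n : lucas 2 n = Z.of_nat n.
Proof.
suff [] : lucas 2 n = Z.of_nat n /\ lucas 2 n.+1 = Z.of_nat n.+1 by [].
elim: n => [//|n [E1 E2]]; split=> //.
by rewrite lucasSS E1 E2; lia.
Qed.

Lemma lucas_coprime b n : rel_prime (lucas b n.+1) (lucas b n).
Proof.
apply: bezout_rel_prime.
apply: (Bezout_intro _ _ _ (lucas b n.+1 - b * lucas b n) (lucas b n)).
by rewrite -[RHS](lucas_norm b n); ring.
Qed.

(* The sequence extended to the left satisfies lucas (-1) = -1, whence the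
   predecessor of [lucas b m] is [b * lucas b m - lucas b m.+1]. *)
Lemma lucas_add0 b n m :
  lucas b (n + m) = lucas b n.+1 * lucas b m
    + lucas b n * (lucas b m.+1 - b * lucas b m).
Proof.
case: m => [|m]; first by rewrite addn0 lucas1 lucas0; ring.
by rewrite addnS lucas_add lucasSS; ring.
Qed.

(** Modulo the m-th term, shifting the index by m multiplies by the next term, by [lucas_add0]. *)
Lemma lucas_mul_mod b m q r :
  exists k, lucas b (q * m + r) = lucas b m * k + lucas b m.+1 ^ Z.of_nat q * lucas b r.
Proof.
elim: q => [|q [k kE]]; first by exists 0; rewrite mul0n add0n Z.pow_0_r; ring.
rewrite Nat2Z.inj_succ Z.pow_succ_r; last lia.
rewrite mulSn -addnA addnC lucas_add0 kE.
set l := lucas b m; set l1 := lucas b m.+1; set p := _ ^ _.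
exists (lucas b (q * m + r).+1 + k * (l1 - b * l) - p * lucas b r * b).
by ring.
Qed.

(** The same expansion, carried to first order in the m-th term. *)
Lemma lucas_mul_mod_sq b m q :
  exists k, lucas b (q.+1 * m) =
    lucas b m * lucas b m * k + Z.of_nat q.+1 * lucas b m * lucas b m.+1 ^ Z.of_nat q.
Proof.
elim: q => [|q [k kE]]; first by exists 0; rewrite mul1n Z.pow_0_r; ring.
have [j jE] := lucas_mul_mod b m q.+1 1.
rewrite addn1 in jE.
have powS : lucas b m.+1 ^ Z.of_nat q.+1 = lucas b m.+1 * lucas b m.+1 ^ Z.of_nat q.
  by rewrite Nat2Z.inj_succ Z.pow_succ_r //; lia.
rewrite mulSn addnC lucas_add0 jE kE (Nat2Z.inj_succ q.+1) powS lucas1.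
set l := lucas b m; set l1 := lucas b m.+1; set p := _ ^ _; set s := Z.of_nat q.+1.
exists (j + k * (l1 - b * l) - s * b * p).
by rewrite /Z.succ; ring.
Qed.

(** Consecutive terms are coprime, so the m-th term divides the term whose index is the remainder of
    n modulo m. That term is smaller, hence zero. *)
Lemma lucas_dvd_index b m n : 2 <= b -> (0 < m)%nat ->
  Z.divide (lucas b m) (lucas b n) -> exists q, n = (q * m)%nat.
Proof.
move=> b2 m0 [e eE].
have [k kE] := lucas_mul_mod b m (n %/ m) (n %% m).
rewrite -divn_eq eE in kE.
have : Z.divide (lucas b m) (lucas b m.+1 ^ Z.of_nat (n %/ m) * lucas b (n %% m)).
  by exists (e - k); rewrite Z.mul_sub_distr_r kE; ring.
move/Gauss => /(_ _) dvd.
have {dvd} dvd : Z.divide (lucas b m) (lucas b (n %% m)).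
  apply: dvd; apply: rel_prime_Zpower_r; first exact: Nat2Z.is_nonneg.
  exact/rel_prime_sym/lucas_coprime.
have r_lt : (n %% m < m)%nat by rewrite ltn_mod.
have [r0|r0] := posnP (n %% m); first by exists (n %/ m); rewrite {1}(divn_eq n m) r0 addn0.
have := Z.divide_pos_le _ _ _ dvd; have := lucas_lt b2 r_lt; have := lucas_lt b2 r0.
by rewrite lucas0; lia.
Qed.

(** With n = q m, the n-th term is, modulo the square, q times the m-th term times a number coprime
    to the m-th term; so the m-th term divides q. *)
Lemma lucas_sq_dvd_index b m n : 2 <= b -> (0 < m)%nat ->
  Z.divide (lucas b m * lucas b m) (lucas b n) -> Z.divide (lucas b m) (Z.of_nat n).
Proof.
move=> b2 m0 [e eE].
have [|q qE] := @lucas_dvd_index b m n b2 m0.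
  by exists (e * lucas b m); rewrite eE; ring.
case: q qE => [|q] qE; first by rewrite qE mul0n; exists 0.
have [k kE] := lucas_mul_mod_sq b m q.
have lm_gt0 : 0 < lucas b m by exact: (lucas_lt b2 m0).
rewrite -qE eE in kE.
have {}kE : lucas b m.+1 ^ Z.of_nat q * Z.of_nat q.+1 = (e - k) * lucas b m.
  by apply: (Z.mul_reg_l _ _ (lucas b m)); [lia|nia].
have dvd : Z.divide (lucas b m) (Z.of_nat q.+1).
  apply: (@Gauss _ (lucas b m.+1 ^ Z.of_nat q)); first by exists (e - k).
  apply: rel_prime_Zpower_r; first exact: Nat2Z.is_nonneg.
  exact/rel_prime_sym/lucas_coprime.
by rewrite qE Nat2Z.inj_mul; apply: Z.divide_mul_l.
Qed.

(** The factor is the companion Lucas number a^(k+1) + a^-(k+1), where a is a root of X^2 - b X + 1;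
    multiplying a term by it adds the two terms at distance k + 1. *)
Lemma lucas_shift_double b k n :
  lucas b (n + 2 * k.+1) + lucas b n
    = (lucas b k.+2 - lucas b k) * lucas b (n + k.+1).
Proof.
rewrite mul2n -addnn addnA addnS lucas_add.
have E1 := lucas_add b n k; have E2 := lucas_add b n k.+1.
rewrite -addnS in E1; rewrite E1 E2 !lucasSS.
set a := lucas b n.+1; set c := lucas b n; have := lucas_norm b k.
set x := lucas b k.+1; set y := lucas b k => E.
rewrite -[X in _ + X]Z.mul_1_r -E; ring.
Qed.

Lemma lucas_reflect b k i : (i <= k.+1)%nat ->
  lucas b (k.+1 + i) - lucas b (k.+1 - i) = (lucas b k.+2 - lucas b k) * lucas b i.
Proof.
suff H : ((i <= k.+1)%nat -> lucas b (k.+1 + i) - lucas b (k.+1 - i)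
     = (lucas b k.+2 - lucas b k) * lucas b i) /\
   ((i.+1 <= k.+1)%nat -> lucas b (k.+1 + i.+1) - lucas b (k.+1 - i.+1)
     = (lucas b k.+2 - lucas b k) * lucas b i.+1) by case: H.
elim: i => [|i [IH1 IH2]].
  split=> _; first by rewrite addn0 subn0 lucas0; ring.
  by rewrite addn1 subn1 lucas1 -pred_Sn; ring.
split=> // ik.
have -> : lucas b (k.+1 - i.+2) = b * lucas b (k.+1 - i.+1) - lucas b (k.+1 - i).
  have -> : (k.+1 - i = (k.+1 - i.+2).+2)%nat by lia.
  have -> : (k.+1 - i.+1 = (k.+1 - i.+2).+1)%nat by lia.
  by rewrite lucasSS; ring.
rewrite !addnS !lucasSS; rewrite !addnS !lucasSS in IH1 IH2.
have {}IH1 := IH1 (ltnW (ltnW ik)); have {}IH2 := IH2 (ltnW ik).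
set V := lucas b (k.+1 - i) in IH1 *; set U := lucas b (k.+1 - i.+1) in IH2 *.
move: IH1 IH2; rewrite !addSn.
set X := lucas b (k + i).+1; set Y := lucas b (k + i) => IH1 IH2.
transitivity (b * ((b * X - Y) - U) - (X - V)); first by ring.
by rewrite IH1 IH2; ring.
Qed.

(* Modulo lucas (k+2) - lucas k, the sequence is antiperiodic with half-period
   2 (k + 1) and symmetric about k + 1. *)
Lemma lucas_fold b k n :
  exists2 j, (j <= k.+1)%nat &
    (Z.divide (Z.of_nat k.+1) (Z.of_nat n - Z.of_nat j) \/
     Z.divide (Z.of_nat k.+1) (Z.of_nat n + Z.of_nat j)) /\
    (Z.divide (lucas b k.+2 - lucas b k) (lucas b n - lucas b j) \/
     Z.divide (lucas b k.+2 - lucas b k) (lucas b n + lucas b j)).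
Proof.
elim/ltn_ind: n => n IHn.
have [nk|kn] := leqP n k.+1.
  by exists n => //; split; left; rewrite Z.sub_diag; apply: Z.divide_0_r.
have [n2k|kn2] := leqP n (2 * k.+1).
  exists (2 * k.+1 - n)%nat; first by lia.
  split; first by right; exists 2; lia.
  left; have ik : (n - k.+1 <= k.+1)%nat by lia.
  have := lucas_reflect b ik.
  have -> : (k.+1 + (n - k.+1) = n)%nat by lia.
  have -> : (k.+1 - (n - k.+1) = 2 * k.+1 - n)%nat by lia.
  by move=> ->; apply: Z.divide_factor_l.
have [|j jk [H1 H2]] := IHn (n - 2 * k.+1)%nat; first by lia.
have E := lucas_shift_double b k (n - 2 * k.+1).
rewrite subnK in E; last by lia.
exists j => //; split.
  by case: H1 => -[e eE]; [left|right]; exists (e + 2); lia.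
case: H2 => -[e eE]; [right|left];
  exists (lucas b (n - 2 * k.+1 + k.+1) - e);
  rewrite Z.mul_sub_distr_r -eE [X in _ = X - _]Z.mul_comm -E; ring.
Qed.

End LucasSequence.

(** * Diophantine descriptions of Lucas terms and of powers *)

Lemma eqmodP d a b : a = b %[mod d] <-> exists k l, a + k * d = b + l * d.
Proof.
split=> [ab|[k [l E]]].
  exists (b %/ d), (a %/ d).
  have := divn_eq a d; have := divn_eq b d; rewrite -ab.
  by move: (a %/ d * d) (b %/ d * d) (a %% d) => p q r; lia.
by rewrite -(modnMDl k a) -(modnMDl l b) addnC E addnC.
Qed.

Lemma eqmodZP d a b :
  a = b %[mod d] <-> Z.divide (Z.of_nat d) (Z.of_nat a - Z.of_nat b).
Proof.
rewrite eqmodP; split=> [[k [l E]]|[e eE]].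
  by exists (Z.of_nat l - Z.of_nat k)%Z; nia.
exists (Z.to_nat (- e)), (Z.to_nat e); nia.
Qed.

Definition luc (b n : nat) : nat := Z.to_nat (lucas (Z.of_nat b) n).

Lemma lucE b n : 2 <= b -> Z.of_nat (luc b n) = lucas (Z.of_nat b) n.
Proof. by move=> b2; rewrite Z2Nat.id //; apply: lucas_ge0; lia. Qed.

(* u and s are terms of the sequence of b whose indices m and k satisfy u | k;
   x is the term of index n, say, of the sequence of w.  Modulo v it agrees with
   the n-th term for b, modulo u with n.  Folding n modulo k to an index j <= k
   gives a = luc b j and c = j. *)
Definition lucas_system (a b c : nat) : Prop :=
  exists u t s r v w x y : nat,
    [/\ u * u + t * t = b * u * t + 1, s * s + r * r = b * s * r + 1 /\ r < s,
        exists e, s = u * u * e & v + 2 * r = b * s] /\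
    [/\ w = b %[mod v], w = 2 %[mod u], 1 < w & x * x + y * y = w * x * y + 1] /\
    [/\ 2 * a < u, 2 * a < v, a = x %[mod v], 2 * c < u & c = x %[mod u]].

Lemma Zdivide_small d a : Z.divide d a -> (Z.abs a < d)%Z -> a = 0%Z.
Proof.
move/Z.divide_abs_r => dvd a_lt; have [//|a0] := Z.eq_dec a 0.
by have := Z.divide_pos_le _ _ _ dvd; lia.
Qed.

Lemma luc_of_system a b c : 4 <= b -> lucas_system a b c -> a = luc b c.
Proof.
move=> b4; have b2 : (2 <= Z.of_nat b)%Z by lia.
have b4Z : (4 <= Z.of_nat b)%Z by lia.
move=> [u [t [s [r [v [w [x [y]]]]]]]].
move=> [[ut [sr rs] [e se] vE] [[/eqmodZP wb /eqmodZP w2 w1 xy]]].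
move=> [au av /eqmodZP ax cu /eqmodZP cx].
have [||||m um] := @lucas_of_norm_sym (Z.of_nat b) (Z.of_nat u) (Z.of_nat t); [lia|lia|lia|nia|].
have [||||k [sk rk]] := @lucas_of_norm (Z.of_nat b) (Z.of_nat s) (Z.of_nat r); [lia|lia|lia|nia|].
have [||||n xn] := @lucas_of_norm_sym (Z.of_nat w) (Z.of_nat x) (Z.of_nat y); [lia|lia|lia|nia|].
have vk : Z.of_nat v = (lucas (Z.of_nat b) k.+2 - lucas (Z.of_nat b) k)%Z.
  by rewrite lucasSS -sk -rk; nia.
have m0 : 0 < m by case: m um => //; rewrite lucas0; lia.
(* Since u^2 divides s, u divides the index k + 1; folding modulo k + 1 thus preserves the index
   modulo u up to sign. *)
have uk : Z.divide (Z.of_nat u) (Z.of_nat k.+1).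
  rewrite um; apply: lucas_sq_dvd_index => //; rewrite -um -sk.
  by exists (Z.of_nat e); nia.
have [j jk [nj lj]] := lucas_fold (Z.of_nat b) k n.
rewrite -vk in lj.
have lj_le : (lucas (Z.of_nat b) j <= Z.of_nat s)%Z by rewrite sk; apply: lucas_le.
have lj_ge : (Z.of_nat j <= lucas (Z.of_nat b) j)%Z by apply: lucas_ge_index.
have anb : Z.divide (Z.of_nat v) (Z.of_nat a - lucas (Z.of_nat b) n).
  have := Z.divide_add_r _ _ _ ax (lucas_mod n wb); rewrite xn.
  by congr Z.divide; ring.
(* Both sides lie below v / 2, as b >= 4 gives 2 s < v. Hence congruence up to sign modulo v is
   equality; the minus sign occurs only if both vanish. *)
have aj : Z.of_nat a = lucas (Z.of_nat b) j.
  have vs : (2 * Z.of_nat s < Z.of_nat v)%Z by nia.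
  have j0 := @lucas_ge0 _ j b2.
  case: lj => H.
    have /Zdivide_small : Z.divide (Z.of_nat v) (Z.of_nat a - lucas (Z.of_nat b) j).
      have := Z.divide_add_r _ _ _ anb H; by congr Z.divide; ring.
    by lia.
  have /Zdivide_small : Z.divide (Z.of_nat v) (Z.of_nat a + lucas (Z.of_nat b) j).
    have := Z.divide_add_r _ _ _ anb H; by congr Z.divide; ring.
  by lia.
have cn : Z.divide (Z.of_nat u) (Z.of_nat c - Z.of_nat n).
  have := Z.divide_add_r _ _ _ cx (lucas_mod n w2); rewrite (lucas2 n) xn.
  by congr Z.divide; ring.
(* Likewise modulo u: c lies below u / 2, and so does j, which is at most a. *)
have cj : c = j.
  case: nj => H.
    have /Zdivide_small : Z.divide (Z.of_nat u) (Z.of_nat c - Z.of_nat j).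
      have := Z.divide_add_r _ _ _ cn (Z.divide_trans _ _ _ uk H).
      by congr Z.divide; ring.
    by lia.
  have /Zdivide_small : Z.divide (Z.of_nat u) (Z.of_nat c + Z.of_nat j).
    have := Z.divide_add_r _ _ _ cn (Z.divide_trans _ _ _ uk H).
    by congr Z.divide; ring.
  by lia.
by rewrite /luc cj -aj Nat2Z.id.
Qed.

Lemma lucas_system_luc b c : 4 <= b -> lucas_system (luc b c) b c.
Proof.
move=> b4; have b2 : (2 <= Z.of_nat b)%Z by lia.
have b4Z : (4 <= Z.of_nat b)%Z by lia.
set a := luc b c; have aE : a = luc b c by []; clearbody a.
have aZ : Z.of_nat a = lucas (Z.of_nat b) c by rewrite aE lucE //; lia.
have ca := @lucas_ge_index _ c b2.
have c1 : (2 * lucas (Z.of_nat b) c < lucas (Z.of_nat b) c.+1)%Z.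
  case: (c) => [|d]; first by rewrite lucas0 lucas1.
  by rewrite lucasSS; have := lucas_bounds d b2; nia.
(* One of two consecutive terms is odd, else the norm 1 would be even. An odd u is needed for
   coprimality with 2 r. *)
have [m cm mE] : exists2 m, c < m & (lucas (Z.of_nat b) m mod 2 = 1)%Z.
  have := lucas_norm (Z.of_nat b) c.+1.
  have [E1|E1] := Z.eq_dec (lucas (Z.of_nat b) c.+1 mod 2) 1; first by exists c.+1.
  have [E2|E2] := Z.eq_dec (lucas (Z.of_nat b) c.+2 mod 2) 1; first by exists c.+2; lia.
  have := Z_div_mod_eq_full (lucas (Z.of_nat b) c.+1) 2.
  have := Z_div_mod_eq_full (lucas (Z.of_nat b) c.+2) 2.
  have := Z.mod_pos_bound (lucas (Z.of_nat b) c.+1) 2 ltac:(lia).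
  have := Z.mod_pos_bound (lucas (Z.of_nat b) c.+2) 2 ltac:(lia).
  move: E1 E2; set X1 := (_ mod 2)%Z; set X2 := (_ mod 2)%Z.
  set Y1 := (_ / 2)%Z; set Y2 := (_ / 2)%Z => E1 E2 B2 B1 F2 F1 G.
  exfalso; have {}E1 : X1 = 0%Z by lia.
  have {}E2 : X2 = 0%Z by lia.
  move: G; rewrite F1 F2 E1 E2 => G.
  have : (2 * (2 * Y2 * Y2 - 2 * Z.of_nat b * Y2 * Y1 + 2 * Y1 * Y1) = 1)%Z by rewrite -G; ring.
  by lia.
set u := lucas (Z.of_nat b) m.
have u_gt : (2 * lucas (Z.of_nat b) c < u)%Z.
  by apply: (Z.lt_le_trans _ _ _ c1); apply: lucas_le.
have u0 : (0 < u)%Z by have := @lucas_ge0 _ c b2; lia.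
(* With index m u, the multiplier in [lucas_mul_mod_sq] is u itself, which supplies the second
   factor u of s. *)
have [k kE] : exists k, k.+1 = m * Z.to_nat u.
  by exists (m * Z.to_nat u).-1; rewrite prednK // muln_gt0; lia.
set s := lucas (Z.of_nat b) k.+1; set r := lucas (Z.of_nat b) k.
have [e se] : Z.divide (u * u) s.
  have [q qE] : exists q, Z.to_nat u = q.+1 by exists (Z.to_nat u).-1; lia.
  have [l lE] := lucas_mul_mod_sq (Z.of_nat b) m q.
  rewrite /s kE mulnC qE lE -qE Z2Nat.id; last lia.
  by exists (l + lucas (Z.of_nat b) m.+1 ^ Z.of_nat q)%Z; rewrite -/u; ring.
have [r0 rs] : (0 <= r < s)%Z by apply: lucas_bounds.
have e0 : (0 <= e)%Z by nia.
set v := (Z.of_nat b * s - 2 * r)%Z.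
have us : (u <= s)%Z.
  by apply: lucas_le => //; rewrite kE; apply: leq_pmulr; lia.
have v_gt : (2 * s <= v)%Z by rewrite /v; nia.
(* As u divides s, v is - 2 r modulo u, and r is coprime to s. *)
have [A [B AB]] : exists A B, (A * u + B * v = 1)%Z.
  have cop : rel_prime u (2 * r).
    apply: rel_prime_mult.
      apply: bezout_rel_prime; apply: (Bezout_intro _ _ _ 1%Z (- (u / 2))%Z).
      by have := Z_div_mod_eq_full u 2; rewrite mE; lia.
    by apply: (@rel_prime_div s); [exact: lucas_coprime|exists (e * u)%Z; rewrite se; ring].
  have [A B AB] := rel_prime_bezout _ _ cop.
  exists (A + B * Z.of_nat b * e * u)%Z, (- B)%Z.
  by rewrite -AB /v se; ring.
(* By the Bezout relation, w0 is b modulo v and 2 modulo u; a large multiple of u v then makes w at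
   least 2. *)
set w0 := (Z.of_nat b * A * u + 2 * B * v)%Z.
set w := (w0 + (Z.abs w0 + 2) * (u * v))%Z.
have uv : (0 < u * v)%Z by nia.
have w2 : (2 <= w)%Z by rewrite /w; nia.
have wu : Z.divide u (w - 2).
  exists (Z.of_nat b * A - 2 * A + (Z.abs w0 + 2) * v)%Z.
  have -> : (w - 2 = w - 2 * (A * u + B * v))%Z by rewrite AB; ring.
  by rewrite /w; set W := Z.abs _; rewrite /w0; ring.
have wv : Z.divide v (w - Z.of_nat b).
  exists (2 * B - Z.of_nat b * B + (Z.abs w0 + 2) * u)%Z.
  have -> : (w - Z.of_nat b = w - Z.of_nat b * (A * u + B * v))%Z by rewrite AB; ring.
  by rewrite /w; set W := Z.abs _; rewrite /w0; ring.
have t0 := @lucas_ge0 _ m.+1 b2.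
have x0 := @lucas_ge0 _ c w2; have y0 := @lucas_ge0 _ c.+1 w2.
have N1 := lucas_norm (Z.of_nat b) m; have N2 := lucas_norm (Z.of_nat b) k.
have N3 := lucas_norm w c.
have am : Z.divide v (Z.of_nat a - lucas w c).
  by rewrite aZ; apply: lucas_mod; rewrite -Z.divide_opp_r; move: wv; congr Z.divide; ring.
have cm' : Z.divide u (Z.of_nat c - lucas w c).
  rewrite -(lucas2 c); apply: lucas_mod.
  by rewrite -Z.divide_opp_r; move: wu; congr Z.divide; ring.
have vE : (v = Z.of_nat b * s - 2 * r)%Z by [].
rewrite -/u in N1; rewrite -/s -/r in N2.
move: (lucas (Z.of_nat b) m.+1) (lucas w c) (lucas w c.+1) t0 x0 y0 N1 N3 am cm'.
move=> t x y t0 x0 y0 N1 N3 am cm'.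
rewrite -aZ in ca u_gt; clearbody w v r s u; clear aE c1 mE kE AB A B w0 uv aZ cm k m b2.
exists (Z.to_nat u), (Z.to_nat t), (Z.to_nat s), (Z.to_nat r),
  (Z.to_nat v), (Z.to_nat w), (Z.to_nat x), (Z.to_nat y).
split; [split|split; split].
- nia.
- by split; nia.
- by exists (Z.to_nat e); nia.
- nia.
- by apply/eqmodZP; rewrite !Z2Nat.id //; lia.
- by apply/eqmodZP; rewrite !Z2Nat.id //; lia.
- lia.
- nia.
- lia.
- lia.
- by apply/eqmodZP; rewrite !Z2Nat.id //; lia.
- lia.
- by apply/eqmodZP; rewrite !Z2Nat.id //; lia.
Qed.

(* q is a root of X^2 - b X + 1 modulo b q - q^2 - 1. *)
Lemma lucas_pow b q n :
  Z.divide (b * q - q * q - 1)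
    (q * lucas b n + lucas b n.+1 - b * lucas b n - q ^ Z.of_nat n).
Proof.
pose g n := (q * lucas b n + lucas b n.+1 - b * lucas b n - q ^ Z.of_nat n)%Z.
suff [] : Z.divide (b * q - q * q - 1) (g n) /\ Z.divide (b * q - q * q - 1) (g n.+1) by [].
elim: n => [|n [[k kE] [l lE]]].
  by split; exists 0%Z; rewrite /g ?lucasSS lucas1 lucas0 ?Z.pow_1_r ?Z.pow_0_r; ring.
split; first by exists l.
exists (b * l - k + q ^ Z.of_nat n)%Z.
have -> : g n.+2 = (b * g n.+1 - g n + (b * q - q * q - 1) * q ^ Z.of_nat n)%Z.
  rewrite /g !lucasSS !Nat2Z.inj_succ !Z.pow_succ_r; [ring|lia|lia].
by rewrite kE lE; ring.
Qed.

(** The shift meets the hypothesis 4 <= b of [luc_of_system] for every b, so that the function is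
    Diophantine without side condition. *)
Definition luc4 b n := luc (b + 4) n.

(* The base d + 4 is so large that q ^ r lies below the modulus m. *)
Definition exp_system (p q r : nat) : Prop :=
  (q = 0 /\ r = 0 /\ p = 1) \/ (q = 0 /\ 0 < r /\ p = 0) \/
  (0 < q /\ exists d m, d = luc4 q r.+1 + q /\ m + q * q + 1 = (d + 4) * q /\ p < m /\
     p + (d + 4) * luc4 d r = q * luc4 d r + luc4 d r.+1 %[mod m]).

Lemma exp_systemP p q r : p = q ^ r <-> exp_system p q r.
Proof.
have [q0|q_gt0] := posnP q.
  rewrite /exp_system q0 ltnn; have [->|r0] := posnP r; first by rewrite expn0; split=> [->|[[_ []]|[[_ []]|[]]]] //; left.
  by rewrite exp0n //; split=> [->|]; [right; left|case=> [[]|[[]|[]]] //; lia].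
rewrite /exp_system; set d := luc4 q r.+1 + q.
(* By [lucas_ge_pow] in base q + 4, the term of index r + 1 is at least (q + 3)^r. This bound puts
   q^r below m. *)
have d_ge : q ^ r + q <= d.
  rewrite leq_add2r; have := @lucas_ge_pow (Z.of_nat (q + 4)) r ltac:(lia).
  rewrite -lucE; last lia; move=> H.
  suff : (Z.of_nat (q ^ r) <= Z.of_nat (luc4 q r.+1))%Z by lia.
  have -> : Z.of_nat (q ^ r) = (Z.of_nat q ^ Z.of_nat r)%Z by lia.
  by apply: Z.le_trans H; apply: Z.pow_le_mono_l; lia.
have qr_gt0 : 0 < q ^ r by rewrite expn_gt0 q_gt0.
have cong m : m + q * q + 1 = (d + 4) * q ->
    q ^ r + (d + 4) * luc4 d r = q * luc4 d r + luc4 d r.+1 %[mod m].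
  move=> mE; apply/eqmodZP.
  have := lucas_pow (Z.of_nat (d + 4)) (Z.of_nat q) r.
  rewrite -!lucE; [|lia..]; rewrite -/(luc4 d r) -/(luc4 d r.+1).
  have -> : (Z.of_nat (d + 4) * Z.of_nat q - Z.of_nat q * Z.of_nat q - 1)%Z = Z.of_nat m by nia.
  have <- : Z.of_nat (q ^ r) = (Z.of_nat q ^ Z.of_nat r)%Z by lia.
  by rewrite -Z.divide_opp_r; congr Z.divide; nia.
split=> [->|[[]|[[]|[_ [d' [m [-> [mE [pm E]]]]]]]]]; [|lia|lia|].
  right; right; split=> //; exists d, ((d + 4) * q - q * q - 1).
  have mE : (d + 4) * q - q * q - 1 + q * q + 1 = (d + 4) * q by nia.
  by split=> //; split=> //; split; [nia|exact: cong].
have := cong _ mE; rewrite -E => /eqP; rewrite eqn_modDr.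
by rewrite !modn_small //; [move/eqP|nia].
Qed.

(** * Diophantine predicates on environments *)

Definition env := nat -> nat.

(* Variable 0 is the innermost bound one, as for [cons_tuple] in [sat]. *)
Definition econs (x : nat) (v : env) : env := fun i => if i is j.+1 then v j else x.

(** Polynomials with non-negative coefficients: an equation between two of them replaces a zero of
    an integer polynomial. Parameters and witnesses come from infinite environments, which spares
    all arity bookkeeping. *)
Inductive pexp : Type :=
| Par (i : nat)
| Wit (j : nat)
| Cst (n : nat)
| Add (e f : pexp)
| Mul (e f : pexp).

Fixpoint peval (v w : env) (e : pexp) : nat :=
  match e with
  | Par i => v i
  | Wit j => w j
  | Cst n => n
  | Add e f => peval v w e + peval v w f
  | Mul e f => peval v w e * peval v w f
  end.

Fixpoint psubst (s t : nat -> pexp) (e : pexp) : pexp :=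
  match e with
  | Par i => s i
  | Wit j => t j
  | Cst n => Cst n
  | Add e f => Add (psubst s t e) (psubst s t f)
  | Mul e f => Mul (psubst s t e) (psubst s t f)
  end.

Lemma peval_ext v v' w w' e : v =1 v' -> w =1 w' -> peval v w e = peval v' w' e.
Proof. by move=> vv' ww'; elim: e => //= e -> f ->. Qed.

Lemma peval_subst v w s t e :
  peval v w (psubst s t e)
    = peval (fun i => peval v w (s i)) (fun j => peval v w (t j)) e.
Proof. by elim: e => //= e -> f ->. Qed.

Definition Dio (P : env -> Prop) : Prop :=
  exists L R, forall v, P v <-> exists w, peval v w L = peval v w R.

Definition DioF (f : env -> nat) : Prop := Dio (fun v => v 0 = f (fun i => v i.+1)).

Lemma dio_ext P Q : (forall v, P v <-> Q v) -> Dio P -> Dio Q.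
Proof. by move=> PQ [L [R LR]]; exists L, R => v; rewrite -PQ. Qed.

(** (L1 - R1) (L2 - R2) = 0, without subtraction; one witness environment serves both sides. *)
Lemma dio_or P Q : Dio P -> Dio Q -> Dio (fun v => P v \/ Q v).
Proof.
move=> [L1 [R1 H1]] [L2 [R2 H2]].
exists (Add (Mul L1 L2) (Mul R1 R2)), (Add (Mul L1 R2) (Mul R1 L2)) => v /=.
rewrite H1 H2; split=> [[] [w E]|[w]]; try by exists w; rewrite E; lia.
move=> /=; case: (ltngtP (peval v w L1) (peval v w R1)) => [lt|lt|E _]; last by left; exists w.
  by move=> E; right; exists w; nia.
by move=> E; right; exists w; nia.
Qed.

(** This is (a - b)^2 + (c - d)^2 = 0 with the negative terms moved to the right. *)
Lemma sum_squares_eq a b c d :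
  a * a + b * b + (c * c + d * d) = 2 * (a * b + c * d) -> a = b /\ c = d.
Proof.
move=> E; set A := Z.of_nat a; set B := Z.of_nat b; set C := Z.of_nat c; set D := Z.of_nat d.
have : ((A - B) * (A - B) + (C - D) * (C - D) = 0)%Z by lia.
have := Z.square_nonneg (A - B); have := Z.square_nonneg (C - D).
move=> H1 H2 H; have H3 : ((A - B) * (A - B) = 0)%Z by lia.
have H4 : ((C - D) * (C - D) = 0)%Z by lia.
by split; nia.
Qed.

(** Even and odd witnesses keep the two equations independent; a sum of squares joins them. *)
Lemma dio_and P Q : Dio P -> Dio Q -> Dio (fun v => P v /\ Q v).
Proof.
move=> [L1 [R1 H1]] [L2 [R2 H2]].
pose even := psubst Par (fun j => Wit j.*2); pose odd := psubst Par (fun j => Wit j.*2.+1).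
pose sq e := Mul e e.
exists (Add (Add (sq (even L1)) (sq (even R1))) (Add (sq (odd L2)) (sq (odd R2)))).
exists (Mul (Cst 2) (Add (Mul (even L1) (even R1)) (Mul (odd L2) (odd R2)))) => v.
rewrite H1 H2; split=> [[[w1 E1] [w2 E2]]|[w]] /=.
  exists (fun j => if ssrnat.odd j then w2 j./2 else w1 j./2).
  rewrite /even /odd !peval_subst /=.
  have W1 e : peval v (fun j => if ssrnat.odd j.*2 then w2 (j.*2)./2 else w1 (j.*2)./2) e
      = peval v w1 e by apply: peval_ext => // j; rewrite odd_double doubleK.
  have W2 e : peval v (fun j => if ~~ ssrnat.odd j.*2 then w2 (uphalf j.*2) else w1 (uphalf j.*2)) e
      = peval v w2 e by apply: peval_ext => // j; rewrite odd_double uphalf_double.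
  by rewrite !W1 !W2 E1 E2; lia.
rewrite /even /odd !peval_subst /= => E.
have [E1 E2] := sum_squares_eq E.
by split; [exists (fun j => w j.*2)|exists (fun j => w j.*2.+1)].
Qed.

Lemma dio_ex (P : nat -> env -> Prop) :
  Dio (fun v => P (v 0) (fun i => v i.+1)) -> Dio (fun v => exists x, P x v).
Proof.
move=> [L [R H]].
pose sub := psubst (fun i => if i is j.+1 then Par j else Wit 0) (fun j => Wit j.+1).
have subE v w e : peval v w (sub e) = peval (econs (w 0) v) (fun j => w j.+1) e.
  by rewrite peval_subst; apply: peval_ext => // -[].
exists (sub L), (sub R) => v; split=> [[x Px]|[w]].
  by have [w E] := (H (econs x v)).1 Px; exists (econs x w); rewrite !subE.
by rewrite !subE => E; exists (w 0); apply/(H (econs (w 0) v)); exists (fun j => w j.+1).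
Qed.

Lemma dio_ren (f : nat -> nat) P : Dio P -> Dio (fun v => P (fun i => v (f i))).
Proof.
move=> [L [R H]]; exists (psubst (Par \o f) Wit L), (psubst (Par \o f) Wit R) => v.
by rewrite H; split=> -[w E]; exists w; move: E; rewrite !peval_subst.
Qed.

Lemma dio_peval_eq L R : Dio (fun v => peval v (fun=> 0) L = peval v (fun=> 0) R).
Proof.
exists (psubst Par (fun=> Cst 0) L), (psubst Par (fun=> Cst 0) R) => v.
split=> [E|[w]]; last by rewrite !peval_subst.
by exists (fun=> 0); rewrite !peval_subst.
Qed.

Lemma dioF_var i : DioF (fun v => v i).
Proof. exact: (dio_peval_eq (Par 0) (Par i.+1)). Qed.

Lemma dioF_cst n : DioF (fun=> n).
Proof. exact: (dio_peval_eq (Par 0) (Cst n)). Qed.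

Lemma dioF_ren (r : nat -> nat) f : DioF f -> DioF (fun v => f (fun i => v (r i))).
Proof. exact: (dio_ren (fun i => if i is j.+1 then (r j).+1 else 0)). Qed.

Lemma dioF_lift f : DioF f -> forall k, Dio (fun v => v 0 = f (fun i => v (k + i).+1)).
Proof.
move=> Df k; exact: (dio_ren (fun i => if i is j.+1 then (k + j).+1 else 0) Df).
Qed.

Lemma dio_comp2 (R : nat -> nat -> Prop) f g :
  Dio (fun v => R (v 0) (v 1)) -> DioF f -> DioF g -> Dio (fun v => R (f v) (g v)).
Proof.
move=> DR Df Dg.
apply: (@dio_ext (fun v => exists x, x = f v /\ exists y, y = g v /\ R x y)).
  move=> v; split=> [[x [-> [y [-> //]]]]|Rf].
  by exists (f v); split=> //; exists (g v).
apply: dio_ex; apply: dio_and => //; apply: dio_ex; apply: dio_and.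
  exact: (dioF_lift Dg 1).
exact: (dio_ren (fun i => if i is 0 then 1 else 0) DR).
Qed.

Lemma dio_comp3 (R : nat -> nat -> nat -> Prop) f g h :
  Dio (fun v => R (v 0) (v 1) (v 2)) -> DioF f -> DioF g -> DioF h ->
  Dio (fun v => R (f v) (g v) (h v)).
Proof.
move=> DR Df Dg Dh.
apply: (@dio_ext (fun v => exists z, z = h v /\ R (f v) (g v) z)).
  by move=> v; split=> [[z [-> //]]|Rf]; exists (h v).
apply: dio_ex; apply: dio_and => //.
apply: (@dio_ext (fun v => exists x, x = f (fun i => v i.+1) /\
   exists y, y = g (fun i => v i.+1) /\ R x y (v 0))).
  move=> v; split=> [[x [-> [y [-> //]]]]|Rf].
  by exists (f (fun i => v i.+1)); split=> //; exists (g (fun i => v i.+1)).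
apply: dio_ex; apply: dio_and; first exact: (dioF_lift Df 1).
apply: dio_ex; apply: dio_and; first exact: (dioF_lift Dg 2).
exact: (dio_ren (fun i => match i with 0 => 1 | 1 => 0 | _ => 2 end) DR).
Qed.

Lemma dioF_comp2 (F : nat -> nat -> nat) f g :
  DioF (fun v => F (v 0) (v 1)) -> DioF f -> DioF g -> DioF (fun v => F (f v) (g v)).
Proof.
move=> DF Df Dg; apply: (@dio_comp3 (fun z x y => z = F x y)) => //.
- exact: (dioF_var 0).
- exact: (dioF_ren S Df).
- exact: (dioF_ren S Dg).
Qed.

Lemma dio_eq f g : DioF f -> DioF g -> Dio (fun v => f v = g v).
Proof. exact/dio_comp2/(dio_peval_eq (Par 0) (Par 1)). Qed.

Lemma dioF_add f g : DioF f -> DioF g -> DioF (fun v => f v + g v).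
Proof. exact/(@dioF_comp2 addn)/(dio_peval_eq (Par 0) (Add (Par 1) (Par 2))). Qed.

Lemma dioF_mul f g : DioF f -> DioF g -> DioF (fun v => f v * g v).
Proof. exact/(@dioF_comp2 muln)/(dio_peval_eq (Par 0) (Mul (Par 1) (Par 2))). Qed.

Lemma dioF_succ f : DioF f -> DioF (fun v => (f v).+1).
Proof.
move=> Df; apply: (@dio_ext (fun v => v 0 = f (fun i => v i.+1) + 1)) => [v|].
  by rewrite addn1.
exact: (dioF_add Df (dioF_cst 1)).
Qed.

(** A hook, tried first by [dio_step] and redefined each time further functions or relations have
    been shown Diophantine. *)
Ltac dio_atom := fail.
Ltac dio_step := first [dio_atom |
  lazymatch goal with
  | |- Dio (fun v => @?P v /\ @?Q v) => apply (@dio_and P Q)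
  | |- Dio (fun v => @?P v \/ @?Q v) => apply (@dio_or P Q)
  | |- Dio (fun v => exists x, @?P v x) => apply (@dio_ex (fun x v => P v x))
  | |- Dio (fun v => @eq nat (@?f v) (@?g v)) => apply (@dio_eq f g)
  | |- DioF (fun v => @?f v + @?g v) => apply (@dioF_add f g)
  | |- DioF (fun v => @?f v * @?g v) => apply (@dioF_mul f g)
  | |- DioF (fun v => (@?f v).+1) => apply (@dioF_succ f)
  | |- DioF (fun v => v ?i) => apply (dioF_var i)
  | |- DioF (fun _ => ?n) => apply (dioF_cst n)
  end].
Ltac dio := repeat (cbv beta; dio_step).

Lemma dio_leq f g : DioF f -> DioF g -> Dio (fun v => f v <= g v).
Proof.
apply: (@dio_comp2 (fun x y => x <= y)).
apply: (@dio_ext (fun v => exists k, v 0 + k = v 1)); last by dio.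
by move=> v; split=> [[k <-]|/subnKC kE]; [apply: leq_addr|exists (v 1 - v 0)].
Qed.

Lemma dio_eqmod f g h :
  DioF f -> DioF g -> DioF h -> Dio (fun v => f v = g v %[mod h v]).
Proof.
apply: (@dio_comp3 (fun x y d => x = y %[mod d])).
apply: (@dio_ext (fun v => exists k l, v 0 + k * v 2 = v 1 + l * v 2)); last by dio.
by move=> v; rewrite eqmodP.
Qed.

Ltac dio_atom ::=
  lazymatch goal with
  | |- Dio (fun v => is_true (@?f v <= @?g v)) => apply (@dio_leq f g)
  | |- Dio (fun v => @?f v = @?g v %[mod @?h v]) => apply (@dio_eqmod f g h)
  end.

(** * Exponentiation, binomial coefficients and factorials *)

Lemma dio_and4 P Q R S :
  Dio P -> Dio Q -> Dio R -> Dio S -> Dio (fun v => [/\ P v, Q v, R v & S v]).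
Proof.
move=> DP DQ DR DS; apply: (@dio_ext (fun v => (P v /\ Q v) /\ (R v /\ S v))).
  by move=> v; split=> [[[]] ? ? []|[]].
by do !apply: dio_and.
Qed.

Lemma dio_and5 P Q R S T : Dio P -> Dio Q -> Dio R -> Dio S -> Dio T ->
  Dio (fun v => [/\ P v, Q v, R v, S v & T v]).
Proof.
move=> DP DQ DR DS DT; apply: (@dio_ext (fun v => P v /\ [/\ Q v, R v, S v & T v])).
  by move=> v; split=> [[? []]|[]].
by apply: dio_and => //; apply: dio_and4.
Qed.

Lemma dioF_luc4 f g : DioF f -> DioF g -> DioF (fun v => luc4 (f v) (g v)).
Proof.
apply: dioF_comp2; apply: (@dio_ext (fun v => lucas_system (v 0) (v 1 + 4) (v 2))).
  move=> v; rewrite /luc4; split=> [|->]; first by apply: luc_of_system; lia.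
  by apply: lucas_system_luc; lia.
rewrite /lucas_system; apply: dio_ex.
do 7 (apply: dio_ex); apply: dio_and; first by apply: dio_and4; dio.
by apply: dio_and; [apply: dio_and4|apply: dio_and5]; dio.
Qed.

Ltac dio_atom ::=
  lazymatch goal with
  | |- Dio (fun v => is_true (@?f v <= @?g v)) => apply (@dio_leq f g)
  | |- Dio (fun v => @?f v = @?g v %[mod @?h v]) => apply (@dio_eqmod f g h)
  | |- DioF (fun v => luc4 (@?f v) (@?g v)) => apply (@dioF_luc4 f g)
  end.

Lemma dioF_exp f g : DioF f -> DioF g -> DioF (fun v => f v ^ g v).
Proof.
apply: dioF_comp2; apply: (@dio_ext (fun v => exp_system (v 0) (v 1) (v 2))).
  by move=> v; rewrite exp_systemP.
by rewrite /exp_system; dio.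
Qed.

Lemma dioF_div f g : DioF f -> DioF g -> DioF (fun v => f v %/ g v).
Proof.
apply: dioF_comp2; apply: (@dio_ext (fun v => (v 2 = 0 /\ v 0 = 0) \/
  exists r, r < v 2 /\ v 1 = v 0 * v 2 + r)); last by dio.
move=> v; split=> [[[-> ->]|[r [rv ->]]]|->].
- by rewrite divn0.
- by rewrite divnMDl ?(divn_small rv); lia.
- case: (posnP (v 2)) => [->|v2]; first by left; rewrite divn0.
  by right; exists (v 1 %% v 2); rewrite ltn_mod -divn_eq.
Qed.

Lemma dioF_mod f g : DioF f -> DioF g -> DioF (fun v => f v %% g v).
Proof.
(* A congruence modulo 0 is an equality, in agreement with x mod 0 = x. *)
apply: dioF_comp2; apply: (@dio_ext (fun v => (v 2 = 0 \/ v 0 < v 2) /\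
  v 0 = v 1 %[mod v 2])); last by dio.
move=> v; split=> [[[->|vv]]|->]; first by rewrite !modn0.
  by rewrite modn_small.
rewrite modn_mod; split=> //; case: (posnP (v 2)) => [|v2]; first by left.
by right; rewrite ltn_mod.
Qed.

Definition digit B N k := N %/ B ^ k %% B.

Lemma digit_sum B (c : nat -> nat) m k : 0 < B -> (forall i, i < m -> c i < B) ->
  digit B (\sum_(i < m) c i * B ^ i) k = if k < m then c k else 0.
Proof.
move=> B0; rewrite /digit; elim: m k c => [|m IHm] k c cB.
  by rewrite big_ord0 div0n mod0n.
rewrite big_ord_recl expn0 muln1.
under eq_bigr => i _ do rewrite lift0 expnS mulnCA.
rewrite -big_distrr /= addnC mulnC.
case: k => [|k]; first by rewrite expn0 divn1 modnMDl modn_small ?cB.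
rewrite expnS divnMA divnMDl // (divn_small (cB 0 isT)) addn0.
by rewrite (IHm k (c \o S)) // => i im; apply: cB.
Qed.

Lemma bin_lt_exp2 n k : 'C(n, k) < (2 ^ n).+1.
Proof.
rewrite ltnS; have [kn|nk] := leqP k n; last by rewrite bin_small.
rewrite -[2]/(1 + 1) expnDn (bigD1 (inord k)) //= inordK // !exp1n !muln1.
exact: leq_addr.
Qed.

(* The binomial theorem, read in base 2^n + 1. *)
Lemma bin_digit n k : 'C(n, k) = digit (2 ^ n).+1 ((2 ^ n).+2 ^ n) k.
Proof.
have -> : (2 ^ n).+2 ^ n = \sum_(i < n.+1) 'C(n, i) * (2 ^ n).+1 ^ i.
  by rewrite -add1n expnDn; apply: eq_bigr => i _; rewrite exp1n mul1n.
rewrite digit_sum //; last by move=> i _; apply: bin_lt_exp2.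
by rewrite ltnS; case: leqP => // /bin_small.
Qed.

Ltac dio_atom ::=
  lazymatch goal with
  | |- Dio (fun v => is_true (@?f v <= @?g v)) => apply (@dio_leq f g)
  | |- Dio (fun v => @?f v = @?g v %[mod @?h v]) => apply (@dio_eqmod f g h)
  | |- DioF (fun v => @?f v ^ @?g v) => apply (@dioF_exp f g)
  | |- DioF (fun v => @?f v %/ @?g v) => apply (@dioF_div f g)
  | |- DioF (fun v => @?f v %% @?g v) => apply (@dioF_mod f g)
  end.

Lemma dioF_bin f g : DioF f -> DioF g -> DioF (fun v => 'C(f v, g v)).
Proof.
move=> Df Dg; rewrite (_ : (fun v => _) =
  (fun v => (2 ^ f v).+2 ^ f v %/ (2 ^ f v).+1 ^ g v %% (2 ^ f v).+1)); last first.
  by apply: funext => v; rewrite bin_digit.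
by dio.
Qed.

(** Replacing one factor r of the power by r - i costs at most i r^n, and i is at most n. *)
Lemma ffact_lower r n : r ^ n.+1 <= r ^_ n.+1 + n.+1 * n.+1 * r ^ n.
Proof.
elim: n => [|n IHn]; first by rewrite expn1 ffactn1; lia.
have H : r ^_ n.+2 = r ^_ n.+1 * (r - n.+1) by rewrite ffactnSr.
have F : r ^_ n.+1 <= r ^ n.+1.
  by elim: (n.+1) => // m IH; rewrite ffactnSr expnSr leq_mul // leq_subr.
have G : r ^_ n.+1 * r <= r ^_ n.+2 + n.+1 * r ^_ n.+1 by rewrite H; nia.
rewrite expnSr; have -> : r ^ n.+1 = r ^ n * r by rewrite expnSr.
rewrite expnSr in IHn F; nia.
Qed.

(* r^n / C(r, n) = n! * r^n / (r (r-1) ... (r-n+1)), which tends to n! from above. *)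
Lemma fact_quotient n r : n * n * (n ^ n).+1 < r -> n`! = r ^ n %/ 'C(r, n).
Proof.
move=> rn; case: n rn => [|n] rn; first by rewrite bin0.
have C0 : 0 < 'C(r, n.+1) by rewrite bin_gt0; nia.
have L := ffact_lower r n; have E := bin_ffact r n.+1.
have fle : n.+1`! <= n.+1 ^ n.+1.
  have H m : m <= n.+1 -> m`! <= n.+1 ^ m.
    elim: m => // m IHm mn; rewrite factS expnS leq_mul //; exact/IHm/ltnW.
  exact: H.
have U : r ^_ n.+1 <= r ^ n.+1.
  by elim: (n.+1) => // m IH; rewrite ffactnSr expnSr leq_mul // leq_subr.
have rp : 0 < r ^ n by rewrite expn_gt0; lia.
apply/eqP; rewrite eqn_leq leq_divRL // mulnC E U /= -ltnS ltn_divLR //.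
rewrite -(ltn_pmul2r (fact_gt0 n.+1)) -mulnA E.
set f := n.+1`! in fle E *; set F := r ^_ n.+1 in L U E *.
have ef : r ^ n.+1 = r ^ n * r by rewrite expnSr.
rewrite ef in L U *; set p := r ^ n in L U rp *.
set s := n.+1 * n.+1 in L rn.
(* The loss s r^n from [ffact_lower], multiplied by n! + 1, stays below one full power r^(n+1); so
   the quotient is less than n! + 1. *)
have H1 : s * f.+1 < r by apply: leq_ltn_trans rn; rewrite leq_mul2l ltnS fle orbT.
by nia.
Qed.

Lemma dioF_fact f : DioF f -> DioF (fun v => (f v)`!).
Proof.
move=> Df; pose r n := (n * n * (n ^ n).+1).+1.
rewrite (_ : (fun v => _) = (fun v => r (f v) ^ f v %/ 'C(r (f v), f v))).
  by rewrite /r; apply: dioF_div; last apply: dioF_bin; dio.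
by apply: funext => v; apply: fact_quotient.
Qed.

(** * Bounded universal quantification *)

Definition pairwise_coprime (d : nat -> nat) y :=
  forall j k, j < k -> k < y -> coprime (d j) (d k).

Lemma coprime_prod_last d y : pairwise_coprime d y.+1 -> coprime (\prod_(k < y) d k) (d y).
Proof.
move=> cop; elim/big_ind: _ => [|a b|k _]; first by rewrite coprime1n.
  by rewrite coprimeMl => -> ->.
exact: cop.
Qed.

Lemma pairwise_coprimeW d y : pairwise_coprime d y.+1 -> pairwise_coprime d y.
Proof. by move=> cop j k jk ky; apply: cop => //; apply: ltnW. Qed.

Lemma crt_exists d r y : pairwise_coprime d y ->
  exists a, forall k, k < y -> a = r k %[mod d k].
Proof.
elim: y => [|y IHy] cop; first by exists 0.
have [a aE] := IHy (pairwise_coprimeW cop).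
have copy := coprime_prod_last cop.
exists (chinese (\prod_(k < y) d k) (d y) a (r y)) => k; rewrite ltnS leq_eqVlt.
case/predU1P => [->|ky]; first exact: chinese_modr.
rewrite -aE //; have dvd : d k %| \prod_(k < y) d k.
  by rewrite (bigD1 (Ordinal ky)) //= dvdn_mulr.
by rewrite -(modn_dvdm _ dvd) chinese_modl // modn_dvdm.
Qed.

Lemma eqmod_prod d a b y : pairwise_coprime d y ->
  (forall k, k < y -> a = b %[mod d k]) -> a = b %[mod \prod_(k < y) d k].
Proof.
elim: y => [|y IHy] cop ab; first by rewrite big_ord0 !modn1.
rewrite big_ord_recr /=; apply/eqP; rewrite chinese_remainder; last exact: coprime_prod_last.
rewrite !(introT eqP) //; first exact: ab.
by apply: IHy => [|k ky]; [apply: pairwise_coprimeW|apply/ab/ltnW].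
Qed.

(* Up to the factor k + 1 this is q + k + 1 with q = T!^2, so that the product over
   k < y is a binomial coefficient. *)
Definition goedel_modulus T k := T`! * T`! %/ k.+1 + 1.

Section GoedelModuli.

Variables (T y : nat).
Hypothesis yT : y <= T.

(** The square is there so that a whole factor T! survives division by k + 1: the modulus is 1
    modulo T!. *)
Lemma goedel_modulusE k : k < y -> goedel_modulus T k = T`! * (T`! %/ k.+1) + 1.
Proof.
by move=> ky; rewrite /goedel_modulus muln_divA // dvdn_fact // (leq_trans ky).
Qed.

Lemma goedel_modulus_mul k :
  k < y -> k.+1 * goedel_modulus T k = T`! * T`! + k.+1.
Proof.
move=> ky; rewrite mulnDr muln1 mulnC divnK // dvdn_mull // dvdn_fact //.
exact: leq_trans yT.
Qed.

Lemma coprime_goedel_fact k : k < y -> coprime (goedel_modulus T k) T`!.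
Proof.
by move=> ky; rewrite goedel_modulusE // mulnC coprime_sym /coprime gcdnMDl gcdn1.
Qed.

(** A common divisor divides (k + 1) d_k - (j + 1) d_j = k - j, hence T!, to which the moduli are
    coprime. *)
Lemma goedel_pairwise_coprime : pairwise_coprime (goedel_modulus T) y.
Proof.
move=> j k jk ky; have jy := ltn_trans jk ky.
set g := gcdn (goedel_modulus T j) (goedel_modulus T k).
have gk : g %| k - j.
  have -> : k - j = k.+1 * goedel_modulus T k - j.+1 * goedel_modulus T j.
    by rewrite !goedel_modulus_mul //; lia.
  by rewrite dvdn_sub // dvdn_mull // ?dvdn_gcdl ?dvdn_gcdr.
have gT : g %| T`! by apply: dvdn_trans gk _; apply: dvdn_fact; lia.
rewrite /coprime -/g -dvdn1 -(eqP (coprime_goedel_fact ky)) dvdn_gcd gT andbT.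
exact: dvdn_gcdr.
Qed.

(** Multiplying by y! turns the product into (q + 1) ... (q + y) with q = T!^2. The closed form
    handles a variable number of factors. *)
Lemma goedel_prod : \prod_(k < y) goedel_modulus T k = 'C(T`! * T`! + y, y).
Proof.
apply/eqP; rewrite -(eqn_pmul2r (fact_gt0 y)) bin_ffact; apply/eqP.
have H z : z <= y -> (\prod_(k < z) goedel_modulus T k) * z`! = (T`! * T`! + z) ^_ z.
  elim: z => [|z IHz] zy; first by rewrite big_ord0 ffactn0.
  rewrite big_ord_recr /= factS addnS ffactSS -addnS -goedel_modulus_mul // -IHz ?(ltnW zy) //.
  by move: (\prod_(k < z) _) (goedel_modulus T z) (z`!) => P d f; lia.
exact: H.
Qed.

Lemma goedel_prime_gt p k : k < y -> prime p -> p %| goedel_modulus T k -> T < p.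
Proof.
move=> ky pp pd; rewrite ltnNge; apply/negP => pT.
have : p %| gcdn (goedel_modulus T k) T`!.
  by rewrite dvdn_gcd pd dvdn_fact // prime_gt0.
by rewrite (eqP (coprime_goedel_fact ky)) dvdn1 => /eqP p1; rewrite p1 in pp.
Qed.

Lemma goedel_modulus_gt1 k : k < y -> 1 < goedel_modulus T k.
Proof.
move=> ky; rewrite goedel_modulusE // addn1 ltnS muln_gt0 fact_gt0 divn_gt0 //.
by apply: dvdn_leq; rewrite ?fact_gt0 // dvdn_fact // (leq_trans ky).
Qed.

End GoedelModuli.

(** By Euclid's lemma p divides some a - i with i <= u. A truncated difference does no harm, since a
    is then itself small. *)
Lemma prime_dvd_ffact p a u : prime p -> u < p -> p %| a ^_ u.+1 -> a %% p <= u.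
Proof.
move=> pp up; elim: u up => [|u IHu] up.
  by rewrite ffactn1 => /eqP ->.
rewrite ffactnSr Euclid_dvdM // => /orP[/(IHu (ltnW up)) /leqW //|].
have [au|ua] := leqP a u.+1; first by rewrite modn_small // (leq_ltn_trans au).
rewrite -eqn_mod_dvd; last exact: ltnW.
by move/eqP => ->; rewrite modn_small.
Qed.

(** The factor a - w occurs in the falling factorial, which is zero anyway if a <= u. *)
Lemma dvd_ffact d a w u : w <= u -> a = w %[mod d] -> d %| a ^_ u.+1.
Proof.
move=> wu aw; have [au|ua] := leqP a u; first by rewrite ffact_small.
have wa : w <= a by apply: leq_trans wu (ltnW ua).
have dvd : d %| a - w by rewrite -eqn_mod_dvd //; apply/eqP.
apply: dvdn_trans dvd _; rewrite ffact_prod (bigD1 (inord w : 'I_u.+1)) //= inordK //.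
exact: dvdn_mulr.
Qed.

Lemma peval_eqmod d v v' w w' e :
  (forall i, v i = v' i %[mod d]) -> (forall j, w j = w' j %[mod d]) ->
  peval v w e = peval v' w' e %[mod d].
Proof.
move=> vv ww; elim: e => //= e IHe f IHf.
  by rewrite -modnDm IHe IHf modnDm.
by rewrite -modnMm IHe IHf modnMm.
Qed.

Lemma peval_mono v v' w w' e :
  (forall i, v i <= v' i) -> (forall j, w j <= w' j) -> peval v w e <= peval v' w' e.
Proof.
move=> vv ww; elim: e => //= e IHe f IHf; first exact: leq_add.
exact: leq_mul.
Qed.

Fixpoint wit_bound (e : pexp) : nat :=
  match e with
  | Wit j => j.+1
  | Add e f | Mul e f => maxn (wit_bound e) (wit_bound f)
  | _ => 0
  end.

Lemma peval_wit_bound m v w w' e : wit_bound e <= m ->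
  (forall j, j < m -> w j = w' j) -> peval v w e = peval v w' e.
Proof.
move=> em ww; elim: e em => //= e IHe f IHf.
  by rewrite geq_max => /andP[/IHe -> /IHf ->].
by rewrite geq_max => /andP[/IHe -> /IHf ->].
Qed.

(** Expressions with [wit_bound] at most m read only the first m witnesses; zeroing the others
    reduces an environment to finitely many numbers. *)
Definition trunc m (w : env) : env := fun j => if j < m then w j else 0.

(* c is congruent to k modulo the k-th modulus d_k, and the a_j code witnesses for
   all k < y: a prime factor p > T of d_k divides C(a_j, u + 1), so a_j mod p <= u,
   and the two sides of the equation at k, being below T, agree once they agree
   modulo p. *)
Definition ball_system L R m (y : nat) (v : env) (u T C c : nat) (a : env) : Prop :=
  [/\ T = peval (econs y v) (trunc m (fun=> u)) (Add L R) + (u + y).+1,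
      C = 'C(T`! * T`! + y, y),
      c.+1 + T`! * T`! = 0 %[mod C],
      peval (econs c v) a L = peval (econs c v) a R %[mod C]
    & forall j, j < m -> 'C(a j, u.+1) = 0 %[mod C]].

Lemma ball_systemP L R m y v : wit_bound L <= m -> wit_bound R <= m ->
  (forall k, k < y -> exists w, peval (econs k v) w L = peval (econs k v) w R) <->
  exists u T C c a, ball_system L R m y v u T C c (trunc m a).
Proof.
move=> Lm Rm; split=> [ex|[u [T [C [c [a [TE CE cE LR aE]]]]]] k ky]; last first.
  have yT : y <= T by lia.
  have uT : u < T by lia.
  have [p pp pd] := pdivP (goedel_modulus_gt1 yT ky).
  have Tp := goedel_prime_gt yT ky pp pd.
  have pC : p %| C.
    by rewrite CE -(goedel_prod yT) (bigD1 (Ordinal ky)) //= dvdn_mulr.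
  (* Modulo p, both c + 1 + T!^2 and (k + 1) d_k = T!^2 + k + 1 vanish. *)
  have ck : c = k %[mod p].
    apply/eqP; rewrite -(eqn_modDr (T`! * T`!).+1) addnS -addSn addnS -addSn.
    rewrite -(modn_dvdm _ pC) cE mod0n mod0n eq_sym.
    by rewrite addnC -(goedel_modulus_mul yT ky); apply: dvdn_mull.
  pose w := trunc m (fun j => a j %% p).
  exists w; have wu j : w j <= trunc m (fun=> u) j.
    rewrite /w /trunc; case: ifP => // jm; apply: prime_dvd_ffact => //.
      exact: ltn_trans Tp.
    rewrite -bin_ffact dvdn_mulr //; apply: dvdn_trans pC _.
    by have := aE j jm; rewrite /trunc jm /dvdn => ->; rewrite mod0n.
  have ww j : w j = trunc m a j %[mod p].
    by rewrite /w /trunc; case: ifP => //; rewrite modn_mod.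
  have E : peval (econs k v) w L = peval (econs k v) w R %[mod p].
    have cons i : econs k v i = econs c v i %[mod p] by case: i.
    rewrite (peval_eqmod L cons ww) (peval_eqmod R cons ww).
    by rewrite -(modn_dvdm _ pC) LR modn_dvdm.
  have le i : econs k v i <= econs y v i by case: i => //=; apply: ltnW.
  have sum_lt : peval (econs y v) (trunc m (fun=> u)) (Add L R) < p.
    by apply: leq_ltn_trans Tp; rewrite TE leq_addr.
  move: E; rewrite !modn_small //; apply: leq_ltn_trans sum_lt.
    by apply: leq_trans (peval_mono R le wu) _; apply: leq_addl.
  by apply: leq_trans (peval_mono L le wu) _; apply: leq_addr.
have [W WE] : exists W : nat -> env, forall k, k < y ->
    peval (econs k v) (W k) L = peval (econs k v) (W k) R.
  have H k : exists w, k < y -> peval (econs k v) w L = peval (econs k v) w R.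
    by case: (ltnP k y) => [/ex [w wE]|]; [exists w|exists (fun=> 0)].
  by have [W] := choice H; exists W.
pose u := \sum_(k < y) \sum_(j < m) W k j.
have Wu k j : k < y -> j < m -> W k j <= u.
  move=> ky jm; rewrite /u (bigD1 (Ordinal ky)) //= (bigD1 (Ordinal jm)) //=.
  by rewrite -addnA leq_addr.
pose T := peval (econs y v) (trunc m (fun=> u)) (Add L R) + (u + y).+1.
have yT : y <= T by rewrite /T; lia.
have uT : u < T by rewrite /T; lia.
pose C := 'C(T`! * T`! + y, y).
have copT := goedel_pairwise_coprime yT.
have C0 : 0 < C by rewrite bin_gt0 leq_addl.
(* A non-negative representative of - (T!^2 + 1) modulo C. *)
pose c := (T`! * T`!).+1 * C.-1.
have cE : c.+1 + T`! * T`! = 0 %[mod C].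
  have -> : c.+1 + T`! * T`! = (T`! * T`!).+1 * C.
    by rewrite /c; move: C0; case: (C) => // C' _; rewrite mulnS; lia.
  by rewrite modnMl mod0n.
have [a aE] : exists a : env, forall j k, k < y -> a j = W k j %[mod goedel_modulus T k].
  have H j := crt_exists (fun k => W k j) copT.
  by have [a] := choice H; exists a.
exists u, T, C, c, a; split=> //.
  rewrite /C -(goedel_prod yT); apply: eqmod_prod => // k ky.
  have dC : goedel_modulus T k %| C.
    by rewrite /C -(goedel_prod yT) (bigD1 (Ordinal ky)) //= dvdn_mulr.
  have ck i : econs c v i = econs k v i %[mod goedel_modulus T k].
    case: i => //=; apply/eqP; rewrite -(eqn_modDr (T`! * T`!).+1) addnS -addSn addnS -addSn.
    rewrite -(modn_dvdm _ dC) cE mod0n mod0n eq_sym.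
    by rewrite addnC -(goedel_modulus_mul yT ky); apply: dvdn_mull.
  have wa j : trunc m a j = trunc m (W k) j %[mod goedel_modulus T k].
    by rewrite /trunc; case: ifP => // _; apply: aE.
  rewrite (peval_eqmod L ck wa) (peval_eqmod R ck wa).
  have tr e : wit_bound e <= m ->
      peval (econs k v) (trunc m (W k)) e = peval (econs k v) (W k) e.
    by move=> em; apply: (peval_wit_bound _ em) => j; rewrite /trunc => ->.
  by rewrite !tr // WE.
move=> j jm; rewrite /trunc jm; apply/eqP; rewrite mod0n -/(dvdn _ _).
(* Being coprime to (u + 1)!, C divides the binomial coefficient as soon as it divides the falling
   factorial. This uses u < T. *)
have copC : coprime C u.+1`!.
  rewrite /C -(goedel_prod yT); elim/big_ind: _ => [|x z|k _]; first by rewrite coprime1n.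
    by rewrite coprimeMl => -> ->.
  apply: coprime_dvdr (coprime_goedel_fact yT (ltn_ord k)).
  by rewrite (fact_split uT) dvdn_mulr.
rewrite -(Gauss_dvdl _ copC) bin_ffact -[_ %| _]/(_ == 0) -(mod0n C); apply/eqP.
rewrite /C -(goedel_prod yT); apply: eqmod_prod => // k ky.
apply/eqP; rewrite mod0n; apply: (@dvd_ffact _ _ (W k j)); first exact: Wu.
exact: aE.
Qed.

Lemma dioF_peval (V W : env -> env) e :
  (forall i, DioF (fun v => V v i)) -> (forall j, DioF (fun v => W v j)) ->
  DioF (fun v => peval (V v) (W v) e).
Proof.
move=> DV DW; elim: e => //= [n|e IHe f IHf|e IHe f IHf]; first exact: dioF_cst.
  exact: dioF_add.
exact: dioF_mul.
Qed.

Lemma dio_True : Dio (fun=> True).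
Proof. by exists (Cst 0), (Cst 0) => v; split=> // _; exists (fun=> 0). Qed.

(** Here m does not depend on the environment, so this is a finite conjunction; a variable bound is
    the matter of [dio_ball]. *)
Lemma dio_all_lt m (P : nat -> env -> Prop) : (forall j, Dio (P j)) ->
  Dio (fun v => forall j, j < m -> P j v).
Proof.
move=> DP; elim: m => [|m IHm]; first by apply: dio_ext dio_True => v; split.
apply: (@dio_ext (fun v => (forall j, j < m -> P j v) /\ P m v)); last exact: dio_and.
move=> v; split=> [[Pj Pm] j|Pj].
  by rewrite ltnS leq_eqVlt => /predU1P[->//|/Pj].
by split=> [j jm|]; apply: Pj => //; apply: ltnW.
Qed.

(** Quantifies a block of m variables at once: they become the first m witnesses, and the old
    witnesses move up by m. *)
Lemma dio_ex_trunc m (P : env -> env -> Prop) :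
  Dio (fun v => P (trunc m v) (fun i => v (m + i))) ->
  Dio (fun v => exists a, P (trunc m a) v).
Proof.
move=> [L [R H]].
pose sub := psubst (fun i => if i < m then Wit i else Par (i - m)) (fun j => Wit (m + j)).
pose join (a v : env) : env := fun i => if i < m then a i else v (i - m).
have joinl a v : trunc m (join a v) = trunc m a.
  by apply: funext => i; rewrite /trunc /join; case: (i < m).
have joinr a v : (fun i => join a v (m + i)) = v.
  by apply: funext => i; rewrite /join ltnNge leq_addr addKn.
have subE v w e : peval v w (sub e) = peval (join w v) (fun j => w (m + j)) e.
  by rewrite peval_subst; apply: peval_ext => // i; rewrite /join; case: (i < m).
have HJ a v : P (trunc m a) v <-> exists w, peval (join a v) w L = peval (join a v) w R.
  by rewrite -H joinl joinr.
exists (sub L), (sub R) => v; split=> [[a /HJ[w E]]|[w]].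
  exists (join a w); rewrite !subE joinr; have E' e : peval (join (join a w) v) w e = peval (join a v) w e.
    by apply: peval_ext => // i; rewrite /join; case: (i < m).
  by rewrite !E'.
by rewrite !subE => E; exists w; apply/HJ; exists (fun j => w (m + j)).
Qed.

Ltac dio_atom ::=
  lazymatch goal with
  | |- Dio (fun v => is_true (@?f v <= @?g v)) => apply (@dio_leq f g)
  | |- Dio (fun v => @?f v = @?g v %[mod @?h v]) => apply (@dio_eqmod f g h)
  | |- DioF (fun v => @?f v ^ @?g v) => apply (@dioF_exp f g)
  | |- DioF (fun v => @?f v %/ @?g v) => apply (@dioF_div f g)
  | |- DioF (fun v => @?f v %% @?g v) => apply (@dioF_mod f g)
  | |- DioF (fun v => 'C(@?f v, @?g v)) => apply (@dioF_bin f g)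
  | |- DioF (fun v => (@?f v)`!) => apply (@dioF_fact f)
  | |- DioF (fun v => peval (@?V v) (@?W v) ?e) => apply (@dioF_peval V W e)
  end.

Lemma dio_ball_var (R : nat -> env -> Prop) :
  Dio (fun v => R (v 0) (fun i => v i.+1)) ->
  Dio (fun v => forall k, k < v 0 -> R k (fun i => v i.+1)).
Proof.
move=> [L [R' H]]; pose m := maxn (wit_bound L) (wit_bound R').
apply: (@dio_ext (fun v => exists u T C c a,
  ball_system L R' m (v 0) (fun i => v i.+1) u T C c (trunc m a))).
  move=> v; rewrite -ball_systemP ?leq_maxl ?leq_maxr //.
  have HR k : R k (fun i => v i.+1) <-> exists w, peval (econs k (fun i => v i.+1)) w L
      = peval (econs k (fun i => v i.+1)) w R'.
    exact: (H (econs k (fun i => v i.+1))).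
  by split=> HH k /HH /HR.
apply: dio_ex; do 3 (apply: dio_ex).
(* The four quantifiers have placed c, C, T, u at variables 0 to 3, so y is variable 4 and its
   parameters start at 5. *)
pose Q (a v : env) := ball_system L R' m (v 4) (fun i => v i.+3.+2) (v 3) (v 2) (v 1) (v 0) a.
apply: (@dio_ex_trunc m Q); rewrite /Q /ball_system.
have Dtrunc (f : env -> env) : (forall j, DioF (fun v => f v j)) ->
    forall j, DioF (fun v => trunc m (f v) j).
  by move=> Df j; rewrite /trunc; case: (j < m) => //; apply: dioF_cst.
have Dcons f g : DioF f -> (forall j, DioF (fun v => g v j)) ->
  forall j, DioF (fun v => econs (f v) (g v) j) by move=> Df Dg [|j] /=.
apply: dio_and5; dio.
- by apply: Dcons => [|j]; dio.
- by apply: (Dtrunc (fun v _ => v (m + 3))) => j; dio.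
- by apply: Dcons => [|j]; dio.
- by apply: (Dtrunc id) => j; dio.
- by apply: Dcons => [|j]; dio.
- by apply: (Dtrunc id) => j; dio.
- apply: dio_all_lt => j; apply: dio_eqmod; last by dio.
    by apply: dioF_bin; [apply: (Dtrunc id) => i; dio|dio].
  by dio.
Qed.

Lemma dio_ball (R : nat -> env -> Prop) f :
  Dio (fun v => R (v 0) (fun i => v i.+1)) -> DioF f ->
  Dio (fun v => forall k, k < f v -> R k v).
Proof.
move=> DR Df.
apply: (@dio_ext (fun v => exists y, y = f v /\ forall k, k < y -> R k v)).
  by move=> v; split=> [[y [-> H]]|H] //; exists (f v).
apply: dio_ex; apply: dio_and => //.
by apply: (@dio_ball_var (fun k v => R k v)).
Qed.

(** * Graphs of partial recursive functions are Diophantine *)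

(** As P reads only m variables, it suffices to quantify over m values and to equate each with its
    substitute. *)
Lemma dio_subst m (P : env -> Prop) (s : env -> env) :
  (forall v v', (forall i, i < m -> v i = v' i) -> P v -> P v') ->
  Dio P -> (forall i, DioF (fun v => s v i)) -> Dio (fun v => P (s v)).
Proof.
move=> Pm DP Ds.
pose Q (a v : env) := (forall j, j < m -> a j = s v j) /\ P a.
apply: (@dio_ext (fun v => exists a, Q (trunc m a) v)).
  move=> v; split=> [[a [as_ Pa]]|Ps]; first exact: Pm Pa.
  exists (s v); split=> [j jm|]; first by rewrite /trunc jm.
  by apply: Pm Ps => j jm; rewrite /trunc jm.
have Dtrunc j : DioF (fun v => trunc m v j).
  by rewrite /trunc; case: (j < m) => //; [apply: dioF_var|apply: dioF_cst].
apply: (@dio_ex_trunc m Q); apply: dio_and.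
  by apply: dio_all_lt => j; apply: dio_eq => //; apply: (dioF_ren (addn m) (Ds j)).
apply: (@dio_ext (fun v => P (fun i => v i))); last exact: (dio_ren id).
by move=> v; split; apply: Pm => i im; rewrite /trunc im.
Qed.

Definition tup n (v : env) : n.-tuple nat := [tuple v i | i < n].

Lemma tup_ext n v v' : (forall i, i < n -> v i = v' i) -> tup n v = tup n v'.
Proof. by move=> vv; apply: eq_from_tnth => i; rewrite !tnth_mktuple vv. Qed.

Lemma tup_nth n (w : n.-tuple nat) : tup n (nth 0 w) = w.
Proof. by apply: eq_from_tnth => i; rewrite tnth_mktuple -tnth_nth. Qed.

Lemma cons_tup n x v : cons_tuple x (tup n v) = tup n.+1 (econs x v).
Proof.
apply: eq_from_tnth => i; rewrite tnth_mktuple.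
case: (unliftP ord0 i) => [j|] ->; last by rewrite tnth0.
by rewrite tnthS tnth_mktuple lift0.
Qed.

Lemma behead_tup n v : behead_tuple (tup n.+1 v) = tup n (fun i => v i.+1).
Proof.
by apply: eq_from_tnth => i; rewrite tnth_behead !tnth_mktuple inordK // ltnS.
Qed.

Lemma thead_tup n v : thead (tup n.+1 v) = v 0.
Proof. exact: tnth_mktuple. Qed.

Definition dio_computable n (f : partrec n) :=
  Dio (fun v => computes f (tup n (fun i => v i.+1)) (v 0)).

Lemma dio_computes_subst n (f : partrec n) (s : env -> env) d :
  dio_computable f -> (forall i, DioF (fun v => s v i)) -> DioF d ->
  Dio (fun v => computes f (tup n (s v)) (d v)).
Proof.
move=> Df Ds Dd.
pose P v := computes f (tup n (fun i => v i.+1)) (v 0).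
apply: (@dio_subst n.+1 P (fun v => econs (d v) (s v))) => [v v' vv||[|i]] //.
  by rewrite /P vv // (@tup_ext _ _ (fun i => v' i.+1)) // => i ni; exact: vv.
exact: Ds.
Qed.

(** The nested recursion is replaced by the sequence of all intermediate values, which the digits of
    one number can code. *)
Lemma computes_RRec n (f : partrec n) (g : partrec n.+2) (v : n.+1.-tuple nat) y :
  computes (RRec f g) v y <-> exists s : nat -> nat,
    [/\ computes f (behead_tuple v) (s 0),
        forall i, i < thead v ->
          computes g (cons_tuple i (cons_tuple (s i) (behead_tuple v))) (s i.+1)
      & y = s (thead v)].
Proof.
rewrite /=; move: (behead_tuple v) (thead v) => x k.
set rec := (fix rec (k y : nat) : Prop := _).
elim: k y => [|k IHk] y.
  by split=> [fy|[s [fs _ ->]] //]; exists (fun=> y); split.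
split=> [[z /IHk[s [fs gs zs]] gy]|[s [fs gs ->]]].
  exists (fun i => if i <= k then s i else y); split=> [//| |].
    move=> i; rewrite ltnS leq_eqVlt => /predU1P[->|ik] /=.
      by rewrite eqxx ltnn -zs.
    by rewrite ik orbT; apply: gs.
  by rewrite ltnn.
exists (s k); last exact: gs.
by apply/IHk; exists s; split=> // i ik; apply: gs; apply: ltnW.
Qed.

Lemma sequence_digits (s : nat -> nat) k :
  exists B N, forall i, i <= k -> digit B N i = s i.
Proof.
pose B := (\sum_(i < k.+1) s i).+1.
exists B, (\sum_(i < k.+1) s i * B ^ i) => i ik.
rewrite digit_sum ?ltnS ?ik // => j jk.
by rewrite ltnS (bigD1 (Ordinal jk)) //= leq_addr.
Qed.

Lemma dio_partrec n (f : partrec n) : dio_computable f.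
Proof.
elim: n / f => [n||n i|m n f IHf g IHg|n f IHf g IHg|n f IHf].
- by rewrite /dio_computable /=; dio.
- rewrite /dio_computable /=; apply: (@dio_ext (fun v => v 0 = (v 1).+1)); last by dio.
  by move=> v; rewrite thead_tup.
- rewrite /dio_computable /=; apply: (@dio_ext (fun v => v 0 = v i.+1)); last by dio.
  by move=> v; rewrite tnth_mktuple.
(* The bound on j stands twice: once for [dio_all_lt], once as the proof that forms the ordinal. *)
- pose Q (a v : env) := (forall j, j < m -> forall jm : j < m,
      computes (g (Ordinal jm)) (tup n (fun i => v i.+1)) (a j)) /\
    computes f (tup m a) (v 0).
  apply: (@dio_ext (fun v => exists a, Q (trunc m a) v)).
    move=> v; split=> [[a [ga fa]]|[w gw fw]].
      exists (tup m (trunc m a)) => // i; rewrite tnth_mktuple.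
      by have := ga i (ltn_ord i) (ltn_ord i); congr computes; congr g; apply: val_inj.
    exists (nth 0 w); have -> : trunc m (nth 0 w) = nth 0 w.
      apply: funext => j; rewrite /trunc; case: ltnP => // mj.
      by rewrite nth_default // size_tuple.
    split; last by rewrite tup_nth.
    by move=> j _ jm; have := gw (Ordinal jm); rewrite (tnth_nth 0).
  have Dtrunc j : DioF (fun v => trunc m v j).
    by rewrite /trunc; case: (j < m) => //; [apply: dioF_var|apply: dioF_cst].
  apply: (@dio_ex_trunc m Q); apply: dio_and.
    apply: dio_all_lt => j.
    have [jm|mj] : j < m \/ m <= j by case: ltnP; [left|right].
      apply: (@dio_ext (fun v => computes (g (Ordinal jm)) (tup n (fun i => v (m + i.+1)))
        (trunc m v j))).
        by move=> v; split=> [H jm'|//]; rewrite (bool_irrelevance jm' jm).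
      by apply: dio_computes_subst => // i; dio.
    by apply: dio_ext dio_True => v; split=> // _ jm; lia.
  by apply: dio_computes_subst => //; dio.
- pose Q B N v := computes f (tup n (fun i => v i.+2)) (digit B N 0) /\
    (forall i, i < v 1 -> computes g
        (tup n.+2 (econs i (econs (digit B N i) (fun i => v i.+2)))) (digit B N i.+1)) /\
    v 0 = digit B N (v 1).
  apply: (@dio_ext (fun v => exists B N, Q B N v)).
    move=> v; rewrite computes_RRec behead_tup thead_tup.
    split=> [[B [N [fs [gs ->]]]]|[s [fs gs vs]]].
      exists (digit B N); split=> // i iv.
      by rewrite !cons_tup; apply: gs.
    have [B [N BN]] := sequence_digits s (v 1); exists B, N; split; first by rewrite BN.
    split; last by rewrite vs BN.
    by move=> i iv; rewrite -!cons_tup !BN //; [apply: gs|apply: ltnW].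
  do 2 (apply: dio_ex); rewrite /Q /digit; apply: dio_and.
    by apply: dio_computes_subst => [//|i|]; dio.
  apply: dio_and; last by dio.
  (* After two quantifiers N and B are variables 0 and 1, the value is 2, the recursion argument 3,
     and the remaining arguments start at 4. *)
  apply: (@dio_ball (fun i v => computes g (tup n.+2 (econs i
    (econs (v 0 %/ v 1 ^ i %% v 1) (fun i => v i.+4)))) (v 0 %/ v 1 ^ i.+1 %% v 1))); last by dio.
  by apply: dio_computes_subst => [//|[|[|i]]|] /=; dio.
- pose Q v := computes f (tup n.+1 v) 0 /\
    forall z, z < v 0 -> exists k, computes f (tup n.+1 (econs z (fun i => v i.+1))) k.+1.
  apply: (@dio_ext Q).
    move=> v /=; rewrite cons_tup.
    have -> : econs (v 0) (fun i => v i.+1) = v by apply: funext => -[].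
    by split=> -[H1 H2]; split=> // z /H2[k]; [rewrite -cons_tup|rewrite cons_tup]; exists k.
  apply: dio_and; first by apply: dio_computes_subst => [//|i|]; dio.
  apply: (@dio_ball (fun z v => exists k, computes f (tup n.+1 (econs z (fun i => v i.+1))) k.+1)); last by dio.
  apply: dio_ex.
  by apply: dio_computes_subst => [//|[|i]|] /=; dio.
Qed.

(** * Computability of positive existential formulas *)

(** Total functions on environments, so that substitution avoids tuples. The equivalence forces h to
    depend on the first n variables only. *)
Definition computable n (h : env -> nat) :=
  exists f : partrec n, forall v y, computes f (tup n v) y <-> y = h v.

Lemma computable_ext n h h' : h =1 h' -> computable n h -> computable n h'.
Proof. by move=> hh [f fE]; exists f => v y; rewrite fE hh. Qed.

Lemma computable_var n i : i < n -> computable n (fun v => v i).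
Proof. by move=> ni; exists (RProj (Ordinal ni)) => v y /=; rewrite tnth_mktuple. Qed.

Lemma computable_subst m n h (g : nat -> env -> nat) :
  computable m h -> (forall i, i < m -> computable n (g i)) ->
  computable n (fun v => h (fun i => g i v)).
Proof.
move=> [f fE] gC.
have [c cE] : exists c : 'I_m -> partrec n,
    forall i v y, computes (c i) (tup n v) y <-> y = g i v.
  have H (i : 'I_m) := gC i (ltn_ord i).
  by have [c cE] := choice H; exists c => i; apply: cE.
exists (RComp f c) => v y /=; split=> [[w /= cw fw]|->].
  suff wE : w = tup m (fun i => g i v) by move: fw; rewrite wE fE.
  by apply: eq_from_tnth => i; rewrite tnth_mktuple; apply/cE.
exists (tup m (fun i => g i v)) => [i|]; first by rewrite tnth_mktuple; apply/cE.
exact/fE.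
Qed.

Lemma computable_comp1 n (h : nat -> nat) f :
  computable 1 (fun v => h (v 0)) -> computable n f -> computable n (fun v => h (f v)).
Proof. by move=> hC fC; apply: (computable_subst (g := fun _ v => f v) hC). Qed.

Lemma computable_comp2 n (h : nat -> nat -> nat) f g :
  computable 2 (fun v => h (v 0) (v 1)) -> computable n f -> computable n g ->
  computable n (fun v => h (f v) (g v)).
Proof.
move=> hC fC gC.
by apply: (computable_subst (g := fun i v => if i is 0 then f v else g v) hC) => -[|i].
Qed.

Lemma computable_succ n f : computable n f -> computable n (fun v => (f v).+1).
Proof.
by apply: (@computable_comp1 _ S); exists RSucc => v y /=; rewrite thead_tup.
Qed.

Lemma computable_cst n c : computable n (fun=> c).
Proof.
by elim: c => [|c IHc]; [exists (RZero n)|apply: computable_succ].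
Qed.

Fixpoint prim_rec (f g : env -> nat) (k : nat) (x : env) : nat :=
  match k with
  | 0 => f x
  | k'.+1 => g (econs k' (econs (prim_rec f g k' x) x))
  end.

Lemma computable_rec n f g : computable n f -> computable n.+2 g ->
  computable n.+1 (fun v => prim_rec f g (v 0) (fun i => v i.+1)).
Proof.
move=> [cf fE] [cg gE]; exists (RRec cf cg) => v y.
rewrite computes_RRec behead_tup thead_tup.
set x := (fun i => v i.+1); split=> [[s [/fE s0 sS ->]]|->].
  elim: (v 0) sS => [|k IHk] sS //=; rewrite -IHk => [|i ik]; last exact/sS/ltnW.
  by apply/gE; rewrite -!cons_tup; apply: sS.
exists (fun k => prim_rec f g k x); split=> // [|i ik]; first exact/fE.
by rewrite !cons_tup; apply/gE.
Qed.

Lemma computable_add n f g :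
  computable n f -> computable n g -> computable n (fun v => f v + g v).
Proof.
apply: (@computable_comp2 _ addn).
apply: computable_ext (computable_rec (computable_var (ltn0Sn 0))
  (computable_succ (@computable_var 3 1 isT))) => v.
by elim: (v 0) => //= k ->; rewrite addSn.
Qed.

Lemma computable_sub n f g :
  computable n f -> computable n g -> computable n (fun v => f v - g v).
Proof.
(* The recursion runs on the subtrahend, which must therefore be variable 0. *)
move=> fC gC; apply: (@computable_comp2 _ (fun y x => x - y)) => //.
have predC : computable 1 (fun v => (v 0).-1).
  apply: computable_ext (computable_rec (computable_cst 0 0) (@computable_var 2 0 isT)) => v.
  by case: (v 0).
apply: computable_ext (computable_rec (computable_var (ltn0Sn 0))
  (computable_comp1 predC (@computable_var 3 1 isT))) => v.
by elim: (v 0) => [|k /= ->] /=; rewrite ?subn0 ?subnS.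
Qed.

Lemma computable_mul n f g :
  computable n f -> computable n g -> computable n (fun v => f v * g v).
Proof.
apply: (@computable_comp2 _ muln).
apply: computable_ext (computable_rec (computable_cst 1 0)
  (computable_add (@computable_var 3 2 isT) (@computable_var 3 1 isT))) => v.
by elim: (v 0) => //= k ->; rewrite mulSn.
Qed.

(** With s the previous root, the truncated difference 1 - ((s + 1)^2 - n) is 1 if (s + 1)^2 <= n
    and 0 otherwise, so the recursion needs no case distinction. *)
Fixpoint isqrt (n : nat) : nat :=
  if n is n'.+1 then isqrt n' + (1 - ((isqrt n').+1 * (isqrt n').+1 - n)) else 0.

Lemma isqrt_bounds n : isqrt n * isqrt n <= n < (isqrt n).+1 * (isqrt n).+1.
Proof.
elim: n => [//|n /andP[IH1 IH2]]; rewrite [isqrt n.+1]/=; set s := isqrt n in IH1 IH2 *.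
have [le|lt] := leqP (s.+1 * s.+1) n.+1.
  rewrite (_ : s.+1 * s.+1 - n.+1 = 0); last by apply/eqP; rewrite subn_eq0.
  by rewrite subn0 addn1; nia.
rewrite (_ : 1 - (s.+1 * s.+1 - n.+1) = 0); last by apply/eqP; rewrite subn_eq0 subn_gt0.
by rewrite addn0; nia.
Qed.

(* The pair (a, b) is coded by (a + b)^2 + a. *)
Definition unl w := w - isqrt w * isqrt w.
Definition unr w := isqrt w - unl w.

(** Since a <= 2 (a + b), the code lies below (a + b + 1)^2 and its integer root is a + b. *)
Lemma unpair_surj a b : exists w, unl w = a /\ unr w = b.
Proof.
exists ((a + b) * (a + b) + a); rewrite /unr /unl.
have := isqrt_bounds ((a + b) * (a + b) + a); set s := isqrt _ => sE.
have -> : s = a + b by nia.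
by lia.
Qed.

Lemma computable_isqrt n f : computable n f -> computable n (fun v => isqrt (f v)).
Proof.
apply: computable_comp1.
have sC : computable 2 (fun v => (v 1).+1) by apply/computable_succ/computable_var.
have gC := computable_add (@computable_var 2 1 isT) (computable_sub (computable_cst 2 1)
  (computable_sub (computable_mul sC sC) (computable_succ (@computable_var 2 0 isT)))).
apply: computable_ext (computable_rec (computable_cst 0 0) gC) => v.
by elim: (v 0) => //= k ->.
Qed.

Lemma computable_unl n f : computable n f -> computable n (fun v => unl (f v)).
Proof.
move=> fC; have sC := computable_isqrt fC.
exact: computable_sub fC (computable_mul sC sC).
Qed.

Lemma computable_unr n f : computable n f -> computable n (fun v => unr (f v)).
Proof. by move=> fC; apply: computable_sub (computable_isqrt fC) (computable_unl fC). Qed.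

Lemma computable_term n (t : term arith_language n) :
  computable n (fun v => teval (N := nat_structure) (tup n v) t).
Proof.
elim: t => [i|[] args IH].
- by apply: computable_ext (computable_var (ltn_ord i)) => v /=; rewrite tnth_mktuple.
- exact: computable_cst.
- exact: computable_cst.
- apply: computable_ext (computable_add (IH ord0) (IH ord_max)) => v /=.
  by rewrite !tnth_mktuple.
- apply: computable_ext (computable_mul (IH ord0) (IH ord_max)) => v /=.
  by rewrite !tnth_mktuple.
Qed.

Lemma computable_shift n f : computable n f -> computable n.+1 (fun v => f (fun i => v i.+1)).
Proof.
by move=> fC; apply: (computable_subst (g := fun i v => v i.+1) fC) => i ni; apply: computable_var.
Qed.

(** Equality becomes the vanishing of both truncated differences, conjunction a sum with paired
    witnesses, disjunction a product with a common witness, and a quantified value is paired with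
    the witness of its matrix. *)
Lemma pe_semidecidable n (phi : pe_formula arith_language n) :
  exists2 F, computable n.+1 F &
    forall v, sat (N := nat_structure) phi (tup n v) <-> exists w, F (econs w v) = 0.
Proof.
have v0 k : computable k.+1 (fun v => v 0) by apply: computable_var.
elim: n / phi => [n t u|n []|n p [F FC FE] q [G GC GE]|n p [F FC FE] q [G GC GE]|n p [F FC FE]].
- have tC := computable_shift (computable_term t).
  have uC := computable_shift (computable_term u).
  eexists; first exact: (computable_add (computable_sub tC uC) (computable_sub uC tC)).
  move=> v /=; split=> [->|[_ /eqP]]; first by exists 0; rewrite subnn.
  by rewrite addn_eq0 !subn_eq0 -eqn_leq => /eqP.
- exists (fun v => F (econs (unl (v 0)) (fun i => v i.+1)) + G (econs (unr (v 0)) (fun i => v i.+1))).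
    apply: computable_add.
      apply: (computable_subst (g := fun i v => econs (unl (v 0)) (fun i => v i.+1) i) FC) => -[|i] ni /=.
        exact: computable_unl.
      exact: computable_var.
    apply: (computable_subst (g := fun i v => econs (unr (v 0)) (fun i => v i.+1) i) GC) => -[|i] ni /=.
      exact: computable_unr.
    exact: computable_var.
  move=> v /=; rewrite FE GE; split=> [[[a Fa] [b Gb]]|[w]].
    by have [w [wa wb]] := unpair_surj a b; exists w; rewrite wa wb Fa Gb.
  move/eqP; rewrite addn_eq0 => /andP[/eqP Fa /eqP Gb].
  by split; [exists (unl w)|exists (unr w)].
- exists (fun v => F v * G v); first exact: computable_mul.
  move=> v /=; rewrite FE GE; split=> [[[w E]|[w E]]|[w /eqP]].
  + by exists w; rewrite E.
  + by exists w; rewrite E muln0.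
  + by rewrite muln_eq0 => /orP[/eqP E|/eqP E]; [left|right]; exists w.
- exists (fun v => F (econs (unl (v 0)) (econs (unr (v 0)) (fun i => v i.+1)))).
    apply: (computable_subst
      (g := fun i v => econs (unl (v 0)) (econs (unr (v 0)) (fun i => v i.+1)) i) FC) => -[|[|i]] ni /=.
    + exact: computable_unl.
    + exact: computable_unr.
    + exact: computable_var.
  move=> v /=; split=> [[x]|[w E]].
    rewrite cons_tup => /FE[a Fa]; have [w [wa wb]] := unpair_surj a x.
    by exists w; rewrite wa wb.
  by exists (unr w); rewrite cons_tup; apply/FE; exists (unl w).
Qed.

(** Unbounded search for w: as F is total, the search is defined at all earlier values and halts
    exactly when a zero exists. *)
Lemma listable_semidecidable n F : computable n.+1 F ->
  listable_set [set v : n.-tuple nat | exists w, F (econs w (nth 0 v)) = 0].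
Proof.
move=> [f fE]; exists (RMu f); apply/seteqP; split=> v /=.
  move=> [w Fw]; have ex : exists w, F (econs w (nth 0 v)) == 0 by exists w; apply/eqP.
  exists (ex_minn ex); case: ex_minnP => y /eqP Fy ymin.
  rewrite -(tup_nth v) cons_tup; split; first by apply/fE; rewrite Fy.
  move=> z zy; exists (F (econs z (nth 0 v))).-1; rewrite cons_tup; apply/fE.
  by rewrite prednK // lt0n; apply: contraL zy => /ymin; rewrite leqNgt.
move=> [y [fy _]]; exists y; move: fy; rewrite -{1}(tup_nth v) cons_tup.
by move/fE.
Qed.

(** * Interpretations *)

Local Open Scope classical_set_scope.

Notation arith_term := (term arith_language).

Definition ord0_elim T (i : 'I_0) : T :=
  match i with Ordinal _ i_lt => False_rect T (notF i_lt) end.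

Definition tapp0 k (f : arith_fsym) (fE : arith_farity f = 0) : arith_term k :=
  @TApp arith_language k f (fun i => ord0_elim _ (cast_ord fE i)).

Definition tadd k (t u : arith_term k) : arith_term k :=
  @TApp arith_language k AAdd (fun i : 'I_2 => if i == ord0 then t else u).

Definition tmul k (t u : arith_term k) : arith_term k :=
  @TApp arith_language k AMul (fun i : 'I_2 => if i == ord0 then t else u).

Arguments tadd : simpl never.
Arguments tmul : simpl never.

(** Out of range the term is 0, matching the default value in [nth 0]. *)
Definition tvar k i : arith_term k :=
  if insub i is Some o then @TVar arith_language k o else tapp0 k (erefl : arith_farity AZero = 0).

Fixpoint tcst k c : arith_term k :=
  if c is c'.+1 then tadd (tcst k c') (tapp0 k (erefl : arith_farity AOne = 0))
  else tapp0 k (erefl : arith_farity AZero = 0).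

Local Notation nteval := (@teval arith_language nat_structure _).

Lemma teval_tvar k (v : k.-tuple nat) i : nteval v (tvar k i) = nth 0 v i.
Proof.
rewrite /tvar; case: insubP => [o _ oi|] /=; first by rewrite (tnth_nth 0) oi.
by rewrite -leqNgt => ki; rewrite nth_default // size_tuple.
Qed.

Lemma teval_tadd k (v : k.-tuple nat) t u :
  nteval v (tadd t u) = nteval v t + nteval v u :> nat.
Proof. by rewrite /tadd /= !tnth_mktuple. Qed.

Lemma teval_tmul k (v : k.-tuple nat) t u :
  nteval v (tmul t u) = nteval v t * nteval v u :> nat.
Proof. by rewrite /tmul /= !tnth_mktuple. Qed.

Lemma teval_tcst k (v : k.-tuple nat) c : nteval v (tcst k c) = c.
Proof. by elim: c => // c IHc; rewrite [tcst _ _]/= teval_tadd IHc addn1. Qed.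

(** Witnesses take the first m variables, since [PEx] binds variable 0. *)
Fixpoint pexp_term m n (e : pexp) : arith_term (m + n) :=
  match e with
  | Par i => tvar (m + n) (m + i)
  | Wit j => tvar (m + n) j
  | Cst c => tcst (m + n) c
  | Add e f => tadd (pexp_term m n e) (pexp_term m n f)
  | Mul e f => tmul (pexp_term m n e) (pexp_term m n f)
  end.

Lemma teval_pexp m n (w : m.-tuple nat) (v : n.-tuple nat) e : wit_bound e <= m ->
  nteval (cat_tuple w v) (pexp_term m n e) = peval (nth 0 v) (nth 0 w) e.
Proof.
elim: e => [i|j|c|e IHe f IHf|e IHe f IHf] em; rewrite [pexp_term _ _ _]/=.
- by rewrite teval_tvar /= nth_cat size_tuple ltnNge leq_addr /= addKn.
- by rewrite teval_tvar /= nth_cat size_tuple ifT.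
- by rewrite teval_tcst.
- rewrite teval_tadd; move: em; rewrite /= geq_max => /andP[em fm].
  by rewrite IHe // IHf.
- rewrite teval_tmul; move: em; rewrite /= geq_max => /andP[em fm].
  by rewrite IHe // IHf.
Qed.

Fixpoint pe_exs n m : pe_formula arith_language (m + n) -> pe_formula arith_language n :=
  match m with
  | 0 => fun phi => phi
  | m'.+1 => fun phi => pe_exs (PEx (phi : pe_formula arith_language (m' + n).+1))
  end.

Lemma sat_exs n m (phi : pe_formula arith_language (m + n)) (v : n.-tuple nat) :
  sat (N := nat_structure) (pe_exs phi) v <->
  exists w : m.-tuple nat, sat (N := nat_structure) phi (cat_tuple w v).
Proof.
elim: m phi => [|m IHm] phi /=.
  have E (w : 0.-tuple nat) : cat_tuple w v = v by rewrite tuple0; apply: val_inj.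
  by split=> [vP|[w]]; [exists [tuple]|]; rewrite E.
rewrite IHm; split=> [[w [x xP]]|[w wP]].
  exists (cons_tuple x w); move: xP; congr (sat phi _); exact: val_inj.
exists (behead_tuple w), (thead w); move: wP; congr (sat phi _).
by apply: val_inj; rewrite /= {1}(tuple_eta w).
Qed.

Lemma dio_definable P k : Dio P ->
  pe_definable (N := nat_structure) [set u : k.-tuple nat | P (nth 0 u)].
Proof.
move=> [L [R H]]; pose m := maxn (wit_bound L) (wit_bound R).
exists (pe_exs (PEq (pexp_term m k L) (pexp_term m k R))).
apply/seteqP; split=> u /=.
  move/H => [w E]; apply/sat_exs; exists (tup m w) => /=.
  rewrite !teval_pexp ?leq_maxl ?leq_maxr //.
  have ww e : wit_bound e <= m -> peval (nth 0 u) (nth 0 (tup m w)) e = peval (nth 0 u) w e.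
    move=> em; apply: (peval_wit_bound _ em) => j jm.
    by rewrite -[j]/(val (Ordinal jm)) -tnth_nth tnth_mktuple.
  by rewrite !ww ?leq_maxl ?leq_maxr.
move/sat_exs => [w /=]; rewrite !teval_pexp ?leq_maxl ?leq_maxr // => E.
by apply/H; exists (nth 0 w).
Qed.

Lemma val_tup n v : val (tup n v) = mkseq v n.
Proof.
apply: (@eq_from_nth _ 0) => [|i]; rewrite ?size_tuple ?size_mkseq // => i_lt.
by rewrite nth_mkseq // -[i]/(val (Ordinal i_lt)) -tnth_nth tnth_mktuple.
Qed.

Lemma interpretable_of_listable L (M : structure L) :
  listable M -> pe_interpretable M nat_structure.
Proof.
move=> [rho rho_surj rhoL].
exists 1, setT, (fun v : 1.-tuple nat => rho (thead v)); split.
- exists (PEq (TVar arith_language (ord0 : 'I_1)) (TVar arith_language ord0)).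
  by apply/seteqP; split.
- move=> m _; have [x _ xm] := rho_surj m I.
  by exists [tuple x] => //; rewrite theadE.
move=> s; have [f fE] := rhoL s; set n := symbol_arity s in f fE *.
have DP : Dio (fun v => exists y, computes f (tup n v) y).
  by apply: dio_ex; exact: dio_partrec f.
have := dio_definable (n * 1) DP; congr pe_definable; apply/seteqP.
have fP (v : n.-tuple nat) : (exists y, computes f v y) <-> symbol_int M s (map_tuple rho v).
  by have := congr1 (fun S => S v) fE => /= ->.
have single (w : seq (1.-tuple nat)) : flatten [seq val x | x <- w] = [seq thead x | x <- w].
  by elim: w => //= x w ->; case/tupleP: x => a x; rewrite (tuple0 x) theadE.
split=> u /=.
  move/fP => su; pose w := map_tuple (fun x => [tuple x]) (tup n (nth 0 u)).
  exists w; first split=> //.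
    by move: su; congr (symbol_int M s _); apply: eq_from_tnth => i; rewrite !tnth_map theadE.
  rewrite single (_ : [seq thead x | x <- w] = val (tup n (nth 0 u))).
    have un : size u = n by rewrite size_tuple muln1.
    by rewrite val_tup -[RHS](congr1 (mkseq (nth 0 u)) un) mkseq_nth.
  by rewrite /= -map_comp; apply: map_id_in => x _; rewrite /= theadE.
move=> [w [_ sw] uw]; apply/fP; move: sw; congr (symbol_int M s _).
apply: eq_from_tnth => i; rewrite !tnth_map tnth_ord_tuple uw single.
by rewrite (nth_map [tuple 0]) ?size_tuple // -tnth_nth.
Qed.

Lemma flatten_mkseq (e : nat -> nat -> nat) r (s : seq nat) :
  flatten [seq mkseq (e^~ z) r | z <- s]
    = mkseq (fun i => e (i %% r) (nth 0 s (i %/ r))) (size s * r).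
Proof.
elim: s => [|z s IHs] //=; rewrite IHs mulSn /mkseq iotaD map_cat add0n; congr (_ ++ _).
  by apply/eq_in_map => i; rewrite mem_iota /= add0n => ir; rewrite modn_small // divn_small.
have -> : iota r (size s * r) = [seq r + i | i <- iota 0 (size s * r)].
  by rewrite -iotaDl addn0.
rewrite -map_comp; apply/eq_in_map => i.
rewrite mem_iota /= add0n => i_lt.
have r0 : 0 < r by case: (r) i_lt => //; rewrite muln0.
by rewrite modnDl divnDl // divnn r0.
Qed.

(** All blocks have length r, so the shape is known and concatenation can be undone. *)
Lemma flatten_uniform_inj T n r (w w' : n.-tuple (r.-tuple T)) :
  flatten [seq val x | x <- w] = flatten [seq val x | x <- w'] -> w = w'.
Proof.
move=> ff; apply: val_inj; apply: (inj_map (val_inj : injective (val : r.-tuple T -> seq T))).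
have sh (x : n.-tuple (r.-tuple T)) : shape [seq val y | y <- x] = nseq n r.
  rewrite /shape -map_comp -[n in RHS](size_tuple x).
  by elim: (val x) => //= y s ->; rewrite size_tuple.
by rewrite -(flattenK [seq val x | x <- w]) -(flattenK [seq val x | x <- w']) ff !sh.
Qed.

(** Iterated pairing: z codes an infinite sequence, and every finite sequence occurs as a prefix. *)
Definition decode i z := unl (iter i unr z).

Lemma decode_surj m (v : env) : exists z, forall i, i < m -> decode i z = v i.
Proof.
elim: m v => [|m IHm] v; first by exists 0.
have [z zE] := IHm (fun i => v i.+1); have [w [w1 w2]] := unpair_surj (v 0) z.
by exists w => -[|i] im //; rewrite /decode iterSr w2 -zE.
Qed.

Lemma computable_decode n i f : computable n f -> computable n (fun v => decode i (f v)).
Proof.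
move=> fC; apply: computable_unl; elim: i => [|i IHi] //=; exact: computable_unr.
Qed.

Lemma computable_local n h v v' :
  computable n h -> (forall i, i < n -> v i = v' i) -> h v = h v'.
Proof. by move=> [f fE] /tup_ext vv; apply/fE; rewrite -vv; apply/fE. Qed.

Lemma listable_of_interpretable L (M : structure L) :
  pe_interpretable M nat_structure -> listable M.
Proof.
move=> [r [D [theta [[phi DE] theta_surj sE]]]].
have [F FC FE] := pe_semidecidable phi.
have DP v : D (tup r v) <-> exists w, F (econs w v) = 0 by rewrite DE /= FE.
have [x0] := dom_inhabited M; have [d0 Dd0 _] := theta_surj x0 I.
(* z codes a witness at entry 0 and a candidate point after it. The factor 1 - F is 1 if the witness
   is good and 0 otherwise; in the latter case the point d0 of D is returned. *)
pose e i z := decode i.+1 z * (1 - F (decode^~ z)) + nth 0 d0 i * (1 - (1 - F (decode^~ z))).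
have eC n i f : computable n f -> computable n (fun v => e i (f v)).
  move=> fC.
  have FdC : computable n (fun v => F (decode^~ (f v))).
    apply: (computable_subst (g := fun i v => decode i (f v)) FC) => j _.
    exact: computable_decode.
  have tC := computable_sub (computable_cst n 1) FdC.
  apply: computable_add; apply: computable_mul => //; first exact: computable_decode.
    exact: computable_cst.
  exact: computable_sub (computable_cst n 1) tC.
have econs_decode z : econs (decode 0 z) (fun i => decode i.+1 z) = decode^~ z.
  by apply: funext => -[].
have eD z : D (tup r (e^~ z)).
  have [F0|F0] := posnP (F (decode^~ z)).
    have -> : tup r (e^~ z) = tup r (fun i => decode i.+1 z).
      by apply: tup_ext => i _; rewrite /e F0 muln1 muln0 addn0.
    by apply/DP; exists (decode 0 z); rewrite econs_decode.
  rewrite (_ : tup r _ = d0) // -[RHS]tup_nth; apply: tup_ext => i _.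
  by rewrite /e (_ : 1 - F _ = 0) ?muln0 ?subn0 ?muln1 //; apply/eqP; rewrite subn_eq0.
exists (fun z => theta (tup r (e^~ z))).
  move=> m _; have [d Dd dm] := theta_surj m I.
  move: Dd; rewrite -{1}[d]tup_nth => /DP[w Fw].
  have [z zE] := decode_surj r.+1 (econs w (nth 0 d)).
  have Fz : F (decode^~ z) = 0 by rewrite -Fw; apply: (computable_local FC).
  exists z => //; rewrite -dm -[in RHS](tup_nth d); congr theta; apply: tup_ext => i ir.
  by rewrite /e Fz subn0 muln1 subnn muln0 addn0 zE.
move=> s; set n := symbol_arity s; have [psi psiE] := sE s.
have [G GC GE] := pe_semidecidable psi.
(* Coordinate i of the concatenated points belongs to block i / r, at position i mod r. *)
pose entries (v : env) : env := fun i => e (i %% r) (v (i %/ r)).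
pose H v := G (econs (v 0) (entries (fun i => v i.+1))).
have HC : computable n.+1 H.
  pose sub i v := econs (v 0) (entries (fun i => v i.+1)) i.
  apply: (computable_subst (g := sub) GC) => -[|i] i_lt; first exact: computable_var.
  by apply: eC; apply: computable_var; rewrite ltnS ltn_divLR //; case: (r) i_lt => //; rewrite muln0.
have := listable_semidecidable HC; congr listable_set; apply/seteqP.
have flat (v : n.-tuple nat) : val (tup (n * r) (entries (nth 0 v)))
    = flatten [seq val x | x <- map_tuple (fun z => tup r (e^~ z)) v].
  rewrite val_tup -[LHS](congr1 (fun k => mkseq _ (k * r)) (size_tuple v)) -flatten_mkseq.
  by rewrite /= -map_comp; congr flatten; apply: eq_map => z /=; rewrite -val_tup.
(* The formula for s only speaks of concatenations; by [flatten_uniform_inj] the tuple of points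
   behind one is the expected tuple. *)
have key (v : n.-tuple nat) : (exists w, H (econs w (nth 0 v)) = 0) <->
    symbol_int M s (map_tuple (fun z => theta (tup r (e^~ z))) v).
  rewrite -[X in X <-> _](GE (entries (nth 0 v))).
  have := congr1 (fun S => S (tup (n * r) (entries (nth 0 v)))) psiE => /= <-.
  have mapE : map_tuple theta (map_tuple (fun z => tup r (e^~ z)) v)
      = map_tuple (fun z => theta (tup r (e^~ z))) v.
    by apply: eq_from_tnth => i; rewrite !tnth_map.
  split=> [[w [wD sw]]|sv].
    by rewrite flat => /flatten_uniform_inj wE; rewrite -mapE wE.
  exists (map_tuple (fun z => tup r (e^~ z)) v); last exact: flat.
  by split=> [i|]; [rewrite tnth_map; apply: eD|rewrite mapE].
by split=> v /key.
Qed.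

Theorem theorem3p13 (L : language) (M : structure L) :
  pe_interpretable M nat_structure <-> listable M.
Proof.
split; [exact: listable_of_interpretable|exact: interpretable_of_listable].
Qed.
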